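(* For every integer $m\ge2$, the polynomial $$P_m(z,w)=z^{m-1}w^m-zw+1$$ is irreducible (in $\mathbb C[z,w]$) and balanced but not excellent balanced. Its branch $f_m(z)=z^{-1}+O(z^{-2})$ at infinity is the Cauchy transform of the Fuss--Catalan probability measure supported on $$[0,K_m],\qquad K_m=\frac{m^m}{(m-1)^{m-1}}.$$ Consequently $f_m$ has a positive mother-body measure and $\delta_{P_m}(f_m;K)=0$ for every compact convex $K\subset\mathbb C$ with $K\supset[0,K_m]$.
   Context: The Fuss--Catalan probability measure (for the parameter $m$) is the probability measure on $[0,K_m]$ whose $k$-th moment is $\frac{1}{(m-1)k+1}\binom{mk}{k}$, $k\ge0$. For a finite compactly supported measure $\mu$ on $\mathbb C$, its Cauchy transform is $\mathcal C_\mu(z)=\int_{\mathbb C}\frac{d\mu(\zeta)}{z-\zeta}$. Balanced: for $P(z,w)=\sum_{(j,k)\in S(P)}a_{j,k}z^jw^k$ with all $a_{j,k}\neq0$, put $m(P)=\min_{(j,k)\in S(P)}(k-j)$; $P$ is balanced if $m(P)=0$. A diagonal monomial $z^nw^n$ is dominant if $j\le n$ and $k\le n$ for every $(j,k)\in S(P)$. A positive branch is a branch of $P(z,w)=0$ at infinity of the form $a_0/z+O(z^{-2})$ with $a_0>0$; a probability branch is one with $a_0=1$. An irreducible balanced polynomial $P$ is excellent balanced if it has a unique probability branch, its support $S(P)$ contains a dominant diagonal monomial, and this probability branch is the only positive branch of $P(z,w)=0$. A positive mother-body measure for a germ $f$ with irreducible defining polynomial $P$ is a positive compactly supported measure whose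 Cauchy transform has germ $f$ at infinity, whose support is a finite union of compact semi-analytic arcs and isolated points, and whose Cauchy transform is a branch of $P(z,w)=0$ in every component of the complement of the support. For compact convex $K$, $\mathcal M_f(K)$ is the set of positive measures supported in $K$ whose Cauchy transform has germ $f$ at infinity; with $d=\deg_wP$, $\mathfrak D_{P,K}(\mu)=\int_K|P(z,\mathcal C_\mu(z))|^{1/d}\,dA(z)$ ($dA$ planar Lebesgue measure) and $\delta_P(f;K)=\min_{\mu\in\mathcal M_f(K)}\mathfrak D_{P,K}(\mu)$. *)

(* Defs.v *)
From HB Require Import structures.
From mathcomp Require Import all_boot all_order all_algebra.
From mathcomp Require Import complex.
From mathcomp Require Import all_classical all_reals all_analysis.

Set Implicit Arguments.
Unset Strict Implicit.
Unset Printing Implicit Defensive.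

Import Order.TTheory GRing.Theory Num.Theory.
Import numFieldNormedType.Exports.

Local Open Scope classical_set_scope.
Local Open Scope ring_scope.
Local Open Scope complex_scope.

(* Functions of a complex variable live on R[i], where the library has the
   algebra, the modulus and complex differentiability.  Measures, supports and
   compact sets live on R * R, where it has the Borel sigma-algebra, the
   topology and the planar Lebesgue measure.  [toC] identifies the two. *)
Notation plane R := (R * R)%type (only parsing).

Definition toC (R : realType) (p : plane R) : R[i] := p.1 +i* p.2.

Definition is_min {d} {T : porderType d} (A : set T) (x : T) : Prop :=
  A x /\ lbound A x.

(* A polynomial in C[z,w] is seen in C[z][w]: P`_k`_j is the coefficient of
   z^j w^k, and (size P).-1 is the degree in w. *)
Definition eval2 (R : realType) (P : {poly {poly R[i]}}) (z w : R[i]) : R[i] :=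
  P.[w%:P].[z].

(* [irreducible_poly] would be irreducibility over a field of coefficients;
   over C[z] it is not the ring-theoretic notion. *)
Definition irreducible_elt (D : idomainType) (a : D) : Prop :=
  [/\ a != 0, a \isn't a GRing.unit &
      forall b c : D, a = b * c -> b \is a GRing.unit \/ c \is a GRing.unit].

Definition psupport (R : realType) (P : {poly {poly R[i]}}) : set (nat * nat) :=
  [set jk | P`_jk.2`_jk.1 != 0].

Definition balanced (R : realType) (P : {poly {poly R[i]}}) : Prop :=
  is_min [set (jk.2%:Z - jk.1%:Z) | jk in psupport P] 0.

Definition dominant_diagonal (R : realType) (P : {poly {poly R[i]}}) (n : nat)
    : Prop :=
  psupport P (n, n) /\
  forall j k, psupport P (j, k) -> (j <= n)%N /\ (k <= n)%N.

Definition exterior (R : realType) (r : R) : set R[i] :=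
  [set z | r%:C < `|z|].

(* Derivability is over the field R[i], that is, complex differentiability. *)
Definition branch_on (R : realType) (P : {poly {poly R[i]}}) (U : set R[i])
    (f : R[i] -> R[i]) : Prop :=
  forall z, U z -> derivable (f : R[i]^o -> R[i]^o) z 1 /\ eval2 P z (f z) = 0.

(* A germ at infinity is represented by any function on R[i] that has it. *)
Definition same_germ (R : realType) (f g : R[i] -> R[i]) : Prop :=
  exists r : R, forall z, exterior r z -> f z = g z.

Definition branch_at_infty (R : realType) (P : {poly {poly R[i]}})
    (f : R[i] -> R[i]) : Prop :=
  exists r : R, branch_on P (exterior r) f.

Definition leading_term (R : realType) (a0 : R) (f : R[i] -> R[i]) : Prop :=
  exists r M : R, forall z, exterior r z ->
    `|f z - a0%:C / z| <= M%:C / `|z| ^+ 2.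

Definition positive_branch (R : realType) (P : {poly {poly R[i]}})
    (f : R[i] -> R[i]) : Prop :=
  branch_at_infty P f /\ exists2 a0 : R, 0 < a0 & leading_term a0 f.

Definition probability_branch (R : realType) (P : {poly {poly R[i]}})
    (f : R[i] -> R[i]) : Prop :=
  branch_at_infty P f /\ leading_term 1 f.

Definition unique_probability_branch (R : realType) (P : {poly {poly R[i]}})
    (f : R[i] -> R[i]) : Prop :=
  probability_branch P f /\ forall g, probability_branch P g -> same_germ g f.

Definition excellent_balanced (R : realType) (P : {poly {poly R[i]}}) : Prop :=
  [/\ irreducible_elt P, balanced P, exists n, dominant_diagonal P n &
      exists2 f, unique_probability_branch P f &
        forall g, positive_branch P g -> same_germ g f].

Definition cintegral (R : realType) (mu : {measure set (plane R) -> \bar R})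
    (g : R[i] -> R[i]) : R[i] :=
  (\int[mu]_p complex.Re (g (toC p))) +i* (\int[mu]_p complex.Im (g (toC p))).

(* For a finite measure the integral converges absolutely for almost every z,
   and for every z outside the support; elsewhere it may be a default value. *)
Definition cauchy_transform (R : realType)
    (mu : {measure set (plane R) -> \bar R}) (z : R[i]) : R[i] :=
  cintegral mu (fun zeta => (z - zeta)^-1).

Definition msupport (R : realType) (mu : {measure set (plane R) -> \bar R})
    : set (plane R) :=
  [set p | forall U : set (plane R), open U -> U p -> (0 < mu U)%E].

Definition area (R : realType) : set (plane R) -> \bar R :=
  (@lebesgue_measure R \x @lebesgue_measure R)%E.
Arguments area R : clear implicits.

Definition analytic_at (R : realType) (f : plane R -> R) (p : plane R) : Prop :=
  exists (c : nat -> nat -> R) (r : R), 0 < r /\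
    forall x y, `|x - p.1| < r -> `|y - p.2| < r ->
      let t i j := c i j * (x - p.1) ^+ i * (y - p.2) ^+ j in
      summable [set: nat * nat] (fun ij => (t ij.1 ij.2)%:E) /\
      (\sum_(i < n) \sum_(j < n) t i j) @[n --> \oo] --> f (x, y).

(* Near every point of the plane, A is a finite union of sets given by finitely
   many analytic equations and strict inequalities.  All the systems have l
   equations and l inequalities, which is no restriction: pad with 0 = 0 and
   0 < 1. *)
Definition semianalytic (R : realType) (A : set (plane R)) : Prop :=
  forall p : plane R, exists U : set (plane R), [/\ open U, U p &
    exists (n l : nat) (g h : 'I_n -> 'I_l -> plane R -> R),
      (forall i j q, U q -> analytic_at (g i j) q /\ analytic_at (h i j) q) /\
      forall q, U q ->
        (A q <-> exists i, forall j, g i j q = 0 /\ 0 < h i j q)].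

Definition topological_arc (R : realType) (A : set (plane R)) : Prop :=
  exists gamma : R -> plane R,
    [/\ {within `[0, 1]%classic, continuous gamma},
        {in `[0, 1]%classic &, injective gamma} &
        A = gamma @` `[0, 1]%classic].

Definition finite_arcs_and_points (R : realType) (A : set (plane R)) : Prop :=
  exists (n : nat) (a : 'I_n -> set (plane R)) (F : set (plane R)),
    [/\ forall i, topological_arc (a i) /\ semianalytic (a i),
        finite_set F, F `<=` isolated A &
        A = \bigcup_i a i `|` F].

Definition mother_body (R : realType) (P : {poly {poly R[i]}})
    (f : R[i] -> R[i]) (mu : {finite_measure set (plane R) -> \bar R})
    : Prop :=
  (irreducible_elt P /\ branch_at_infty P f) /\
  [/\ compact (msupport mu),
      same_germ (cauchy_transform mu) f,
      finite_arcs_and_points (msupport mu) &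
      forall p, (~` msupport mu) p ->
        branch_on P (@toC R @` connected_component (~` msupport mu) p)
          (cauchy_transform mu)].

Definition admissible (R : realType) (f : R[i] -> R[i]) (K : set (plane R))
    : set {finite_measure set (plane R) -> \bar R} :=
  [set mu | msupport mu `<=` K /\ same_germ (cauchy_transform mu) f].

Definition defect (R : realType) (P : {poly {poly R[i]}}) (K : set (plane R))
    (mu : {finite_measure set (plane R) -> \bar R}) : \bar R :=
  (\int[area R]_(p in K)
    (Normc.normc (eval2 P (toC p) (cauchy_transform mu (toC p)))
       `^ ((size P).-1%:R^-1))%:E)%E.

Definition is_delta (R : realType) (P : {poly {poly R[i]}})
    (f : R[i] -> R[i]) (K : set (plane R)) (v : \bar R) : Prop :=
  is_min (defect P K @` admissible f K) v.

Definition convex_plane (R : realType) (K : set (plane R)) : Prop :=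
  @convex_set R (R^o * R^o)%type K.

Definition fc_poly (R : realType) (m : nat) : {poly {poly R[i]}} :=
  'X%:P ^+ (m - 1) * 'X ^+ m - 'X%:P * 'X + 1.

Definition fc_bound (R : realType) (m : nat) : R :=
  m%:R ^+ m / (m - 1)%:R ^+ (m - 1).

Definition fc_segment (R : realType) (m : nat) : set (plane R) :=
  [set p | 0 <= p.1 <= fc_bound R m /\ p.2 = 0].
Arguments fc_segment R m : clear implicits.

Definition fuss_catalan (R : realType) (m : nat) (mu : probability (plane R) R)
    : Prop :=
  mu (~` fc_segment R m) = 0%E /\
  forall k : nat,
    cintegral mu (fun z => z ^+ k) = 'C(m * k, k)%:R / ((m - 1) * k + 1)%:R.

(* Main.v *)
(* Write [u = z w], so that [P_m (z, w) = 0] becomes [u ^ m = z (u - 1)].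

   Irreducibility: substituting [w = u / z] turns a factorization of [P_m] into
   one of [z ^ (m - 1) (u ^ m + z (1 - u))], in which the factor linear in [z]
   is primitive; so one factor of [P_m] is a unit.  Excellence fails because the
   support [(0, 0), (1, 1), (m - 1, m)] has no dominant diagonal monomial.

   Measure: on the curve [v = r e ^ (i m phi)], [r = sin phi / sin ((m - 1) phi)],
   the function [x = (1 + v) ^ m / v] is real.  Expanding [x ^ k] and integrating
   [d log v] along the curve shows that [x] has moments [binom (m k) k] when
   [phi] is uniform on [[0, pi / m]].  Multiplying by [s ^ (m - 1)], with [s]
   uniform on [[0, 1]] and independent, divides them by [(m - 1) k + 1].

   Cauchy transform: the moments satisfy the convolution identity
   [sum_k A_k t ^ k = 1 + t (sum_k A_k t ^ k) ^ m], which is [P_m (z, C z) = 0]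
   near infinity with [t = 1 / z].  Any point off the segment lies outside some
   disc containing the segment, and [C] is given outside that disc by a single
   power series in [1 / (z - c)]; hence the equation holds everywhere off the
   segment.  The support being the segment, which has area zero, the measure is
   a mother body and its defect vanishes. *)

From HB Require Import structures.
Require Import Defs.
From mathcomp Require Import all_boot all_order all_algebra fraction.
From mathcomp Require Import complex.
From mathcomp Require Import ring lra zify.
From mathcomp Require Import all_classical all_reals all_analysis.
From mathcomp Require Import measurable_realfun.

Set Implicit Arguments.
Unset Strict Implicit.
Unset Printing Implicit Defensive.

Import Order.TTheory GRing.Theory Num.Theory.
Import numFieldNormedType.Exports.
Local Open Scope classical_set_scope.
Local Open Scope ring_scope.

(** * Irreducibility *)

Local Notation frac := (@tofrac _).

(** The value [y ^ n p(x / y)] with denominators cleared, so that the substitution [w = u / z] stays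
    inside a polynomial ring. *)
Definition homog (D : comNzRingType) (n : nat) (p : {poly D}) (x y : D) : D :=
  \sum_(k < n.+1) p`_k * x ^+ k * y ^+ (n - k).

Lemma homogE (D : idomainType) n (p : {poly D}) (x y : D) :
  (size p <= n.+1)%N -> y != 0 ->
  frac (homog n p x y) = frac y ^+ n * (map_poly frac p).[frac x / frac y].
Proof.
move=> sp y0; have y0' : frac y != 0 by rewrite tofrac_eq0.
rewrite (@horner_coef_wide _ n.+1) ?(leq_trans (size_poly _ _)) //.
rewrite rmorph_sum mulr_sumr; apply: eq_bigr => k _ /=.
rewrite coef_map_id0 ?rmorph0 // !rmorphM !rmorphXn /= expr_div_n.
have -> : frac y ^+ n = frac y ^+ (n - k) * frac y ^+ k.
  by rewrite -exprD subnK // -ltnS.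
rewrite mulrC -[RHS]mulrA; congr (_ * _).
by rewrite [RHS]mulrC -!mulrA mulVf ?mulr1 ?expf_neq0.
Qed.

(** In the fraction field both sides are [y ^ (a + b)] times the value of [p q] at [x / y]. *)
Lemma homogM (D : idomainType) a b (p q : {poly D}) (x y : D) :
  (size p <= a.+1)%N -> (size q <= b.+1)%N -> y != 0 ->
  homog (a + b) (p * q) x y = homog a p x y * homog b q x y.
Proof.
move=> sp sq y0; have spq : (size (p * q)%R <= (a + b).+1)%N.
  by rewrite (leq_trans (size_polyMleq _ _)) //; lia.
apply/eqP; rewrite -tofrac_eq rmorphM /= !homogE //.
by rewrite [map_poly _ (p * q)]rmorphM hornerM exprD mulrACA.
Qed.

Lemma homogD (D : comNzRingType) n (p q : {poly D}) (x y : D) :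
  homog n (p + q) x y = homog n p x y + homog n q x y.
Proof.
by rewrite -big_split /=; apply: eq_bigr => k _; rewrite coefD !mulrDl.
Qed.

Lemma homog_monomial (D : comNzRingType) n j (c x y : D) : (j <= n)%N ->
  homog n (c%:P * 'X^j) x y = c * x ^+ j * y ^+ (n - j).
Proof.
rewrite -ltnS => jn; rewrite /homog (bigD1 (Ordinal jn)) //= big1 => [|k kj].
  by rewrite coefCM coefXn eqxx mulr1 addr0.
by rewrite coefCM coefXn -val_eqE /= in kj *; rewrite (negPf kj) mulr0 !mul0r.
Qed.

(** Induction on [n]: the product of the constant coefficients vanishes, so one ['X] comes off one
    of the factors. At [n = 0] the degree is one, hence one factor is a constant [k], which divides
    both [e] and [d]. *)
Lemma factors_of_Xn_linear (D : idomainType) n (b c : {poly D}) (e d : D) :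
  d != 0 -> e != 0 -> b * c = 'X^n * (e *: 'X + d%:P) ->
  exists (k : D) i (l : {poly D}), k *: l = e *: 'X + d%:P /\
    (b = k *: 'X^i \/ c = k *: 'X^i).
Proof.
move=> d0 e0; elim: n b c => [|n IH] b c bc.
  have szL : size (e *: 'X + d%:P) = 2%N.
    by rewrite -mul_polyC size_MXaddC polyC_eq0 (negPf e0) /= size_polyC e0.
  have L0 : e *: 'X + d%:P != 0 by rewrite -size_poly_eq0 szL.
  have : b * c != 0 by rewrite bc expr0 mul1r.
  rewrite mulf_eq0 negb_or => /andP[b0 c0].
  have : size (b * c)%R = 2%N by rewrite bc expr0 mul1r.
  have scb : forall p : {poly D}, p != 0 -> (0 < size p)%N.
    by move=> p; rewrite size_poly_gt0.
  rewrite size_mul // => sbc; have sb := scb _ b0; have sc := scb _ c0.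
  have [sb1|sc1] : (size b <= 1)%N \/ (size c <= 1)%N by lia.
    exists b`_0, 0%N, c; rewrite expr0 -!mul_polyC mulr1 -(size1_polyC sb1) bc.
    by rewrite expr0 mul1r mul_polyC; split=> //; left.
  exists c`_0, 0%N, b; rewrite expr0 -!mul_polyC mulr1 -(size1_polyC sc1) mulrC bc.
  by rewrite expr0 mul1r mul_polyC; split=> //; right.
have divX (p : {poly D}) : p`_0 = 0 -> exists q, p = q * 'X.
  move=> p0; exists (drop_poly 1 p); rewrite -[LHS](poly_take_drop 1) expr1.
  suff -> : take_poly 1 p = 0 by rewrite add0r.
  by apply/polyP => -[|i]; rewrite coef_take_poly coef0.
have : (b * c)`_0 = 0 by rewrite bc exprS -mulrA coefXM.
rewrite coef0M => /eqP; rewrite mulf_eq0 => /orP[] /eqP /divX [q Eq].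
- have /IH[k [i [l [kl H]]]] : q * c = 'X^n * (e *: 'X + d%:P).
    by apply: (mulIf (negbT (polyX_eq0 D))); rewrite mulrAC -Eq bc exprS -mulrA [LHS]mulrC.
  exists k; case: H => H; [exists i.+1|exists i]; exists l; split=> //.
    by left; rewrite Eq H exprSr scalerAl.
  by right.
- have /IH[k [i [l [kl H]]]] : b * q = 'X^n * (e *: 'X + d%:P).
    by apply: (mulIf (negbT (polyX_eq0 D))); rewrite -mulrA -Eq bc exprS -mulrA [LHS]mulrC.
  exists k; case: H => H; [exists i|exists i.+1]; exists l; split=> //.
    by left.
  by right; rewrite Eq H exprSr scalerAl.
Qed.

(** The identity [(1 - X) (1 + ... + X ^ (n - 1)) + X ^ n = 1] shows that a common divisor is a unit
    of [F[X]]. *)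
Lemma dvd_Xn_1subX (F : fieldType) n (k p q : {poly F}) :
  k * p = 1 - 'X -> k * q = 'X^n -> exists2 c, c != 0 & k = c%:P.
Proof.
move=> kp kq.
have k1 : k * (p * (\sum_(i < n) 'X^i) + q) = 1.
  rewrite mulrDr mulrA kp kq -opprB mulNr.
  by rewrite -subrX1 opprB subrK.
have k0 : k != 0 by apply: contra_eqN k1 => /eqP ->; rewrite mul0r eq_sym oner_eq0.
have : k \is a GRing.unit.
  by apply/unitrP; exists (p * (\sum_(i < n) 'X^i) + q); rewrite [_ * k]mulrC.
rewrite poly_unitE => /andP[/eqP sk _].
exists k`_0; last by rewrite -size1_polyC // sk.
by apply: contra_neq k0 => k00; rewrite [k]size1_polyC ?sk // k00.
Qed.

(** The outer variable is [z] and the inner one [u]. The monomial [z ^ i w ^ l] becomes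
    [z ^ (i + n - l) u ^ l], so distinct monomials stay distinct and every coefficient of [b] can be
    read off. *)
Lemma coef_homog (F : fieldType) n (b : {poly {poly F}}) i l :
  (l <= n)%N ->
  (homog n (map_poly (map_poly polyC) b) ('X%:P) 'X)`_(i + (n - l))`_l = b`_l`_i.
Proof.
move=> ln; rewrite /homog coef_sum coef_sum.
rewrite (bigD1 (Ordinal (ltn_ord (inord l : 'I_n.+1)))) //=.
rewrite big1 => [|k kl].
  rewrite addr0 inordK // coefMXn ltnNge leq_addl /= addnK.
  rewrite -rmorphXn coefMC !coef_map_id0 ?rmorph0 //.
  by rewrite coefCM coefXn eqxx mulr1.
rewrite coefMXn; case: ifP => _; first by rewrite coef0.
rewrite -rmorphXn coefMC !coef_map_id0 ?rmorph0 //.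
rewrite coefCM coefXn; case: eqP => [lk|]; last by rewrite mulr0.
by case/eqP: kl; apply: val_inj; rewrite /= inordK.
Qed.

(** If no [u] occurs after homogenization, then no [w] occurs in [b], which thus reduces to its unit
    constant term. *)
Lemma homog_monomial_unit (F : fieldType) n (b : {poly {poly F}}) (c : F) i :
  (size b <= n.+1)%N -> b`_0 \is a GRing.unit ->
  homog n (map_poly (map_poly polyC) b) ('X%:P) 'X = c%:P *: 'X^i ->
  b \is a GRing.unit.
Proof.
move=> sb ub Hb.
have -> : b = (b`_0)%:P.
  apply/polyP => -[|l]; rewrite coefC //=.
  have [ln|nl] := leqP l.+1 n; last by rewrite nth_default // (leq_trans sb).
  apply/polyP => j; rewrite coef0 -(@coef_homog _ n) // Hb coefZ.
  by rewrite coefXn mulr_natr coefMn coefC /= mul0rn.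
by rewrite rmorph_unit.
Qed.

Lemma homog_fc_identity (D : comNzRingType) (x z : D) k :
  z ^+ k * x ^+ k.+1 + - z * x * z ^+ k + z ^+ k.+1 =
  z ^+ k * ((1 - x) * z + x ^+ k.+1).
Proof. by rewrite !exprS; ring. Qed.

Lemma coef_fc_poly (F : fieldType) m i :
  ('X%:P ^+ (m - 1) * 'X ^+ m - 'X%:P * 'X + 1 : {poly {poly F}})`_i =
  'X ^+ (m - 1) *+ (i == m) - 'X *+ (i == 1%N) + 1 *+ (i == 0%N).
Proof.
by rewrite !coefD coefN -rmorphXn !coefCM coefXn coefX coef1 !mulr_natr.
Qed.

Lemma fc_poly_irreducible (F : fieldType) m :
  (2 <= m)%N ->
  irreducible_elt ('X%:P ^+ (m - 1) * 'X ^+ m - 'X%:P * 'X + 1 : {poly {poly F}}).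
Proof.
move=> m2; set P := (X in irreducible_elt X).
have coefP i : P`_i = 'X ^+ (m - 1) *+ (i == m) - 'X *+ (i == 1%N) + 1 *+ (i == 0%N).
  exact: coef_fc_poly.
have P0 : P`_0 = 1.
  rewrite coefP /= (_ : (0 == m)%N = false); last by lia.
  by rewrite mulr0n subr0 add0r.
have Pm : P`_m = 'X ^+ (m - 1).
  rewrite coefP eqxx (_ : (m == 1)%N = false); last by lia.
  by rewrite (_ : (m == 0)%N = false) ?subr0 ?addr0 //; lia.
have sP : size P = m.+1.
  apply/eqP; rewrite eqn_leq; apply/andP; split.
    apply/leq_sizeP => j mj; rewrite coefP.
    have [-> -> ->] : [/\ (j == m) = false, (j == 1%N) = false & (j == 0%N) = false].
      by split; lia.
    by rewrite !mulr0n subr0 addr0.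
  rewrite ltnNge; apply/negP => /leq_sizeP/(_ m (leqnn _)).
  by rewrite Pm => /eqP; rewrite expf_eq0 polyX_eq0 andbF.
have nzP : P != 0 by rewrite -size_poly_eq0 sP.
split=> //; first by rewrite poly_unitE sP; case: (m) m2.
move=> b c Pbc.
have /andP[b0 c0] : (b != 0) && (c != 0) by rewrite -negb_or -mulf_eq0 -Pbc.
have [sb sc] : (0 < size b /\ 0 < size c)%N by rewrite !size_poly_gt0.
(* The terms of [b] and [c] free of [w] multiply to 1, so both are units; this excludes nontrivial
   powers of [z] as factors. *)
have ubc : b`_0 * c`_0 = 1 by rewrite -coef0M -Pbc P0.
have ub : b`_0 \is a GRing.unit by apply/unitrP; exists c`_0; rewrite [c`_0 * _]mulrC.
have uc : c`_0 \is a GRing.unit by apply/unitrP; exists b`_0; rewrite [c`_0 * _]mulrC.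
(* [lift] goes from [F[z][w]] to [F[u][z][w]], and [h n p] is [z ^ n p(z, u / z)]. *)
pose lift := map_poly (map_poly (@polyC F)) : {poly {poly F}} -> _.
pose h n p := homog n (lift p) ('X%:P) 'X.
have hM : h m P = h (size b).-1 b * h (size c).-1 c.
  have -> : m = ((size b).-1 + (size c).-1)%N.
    by have := size_mul b0 c0; rewrite -Pbc sP; lia.
  rewrite /h Pbc /lift rmorphM homogM ?polyX_eq0 //;
    by rewrite (leq_trans (size_poly _ _)) ?prednK.
have hP : h m P = 'X^(m - 1) * ((1 - 'X) *: 'X + ('X^m)%:P).
  have liftP : lift P = 'X%:P ^+ (m - 1) * 'X ^+ m - 'X%:P * 'X + 1.
    rewrite /lift /P rmorphD rmorphB !rmorphM !rmorphXn rmorph1 /=.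
    by rewrite !map_polyX !map_polyC /= !map_polyX.
  have liftP2 : lift P = ('X ^+ (m - 1))%:P * 'X^m + (- 'X)%:P * 'X^1 + 1%:P * 'X^0.
    by rewrite liftP rmorphXn polyCN mulNr expr0 mulr1 expr1.
  rewrite /h liftP2 !homogD !homog_monomial //; last by lia.
  rewrite subnn subn0 expr0 !mulr1 mul1r expr1 -mul_polyC rmorphB rmorph1 rmorphXn.
  have mE : (m - 1).+1 = m by lia.
  by have := homog_fc_identity ('X%:P : {poly {poly F}}) 'X (m - 1); rewrite mE.
have [] := @factors_of_Xn_linear _ (m - 1) (h (size b).-1 b) (h (size c).-1 c)
  (1 - 'X) ('X^m).
- by rewrite expf_neq0 // polyX_eq0.
- by rewrite -opprB oppr_eq0 polyXsubC_eq0.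
- by rewrite -hM hP.
(* Comparing coefficients of [z], [k] divides [1 - u] and [u ^ m], so it is a constant, and one of
   the two homogenized factors is a constant times a power of [z]. *)
move=> k [i [l [kl H]]].
have [e e0 ke] : exists2 e, e != 0 & k = e%:P.
  apply: (@dvd_Xn_1subX _ m k l`_1 l`_0).
    by have := congr1 (fun p : {poly {poly F}} => p`_1) kl;
      rewrite /= !coefE /= mulr1 addr0.
  by have := congr1 (fun p : {poly {poly F}} => p`_0) kl;
      rewrite /= !coefE /= mulr0 add0r.
rewrite ke in H; case: H => H; [left|right].
  by apply: homog_monomial_unit H; rewrite ?prednK.
by apply: homog_monomial_unit H; rewrite ?prednK.
Qed.

(** * Fuss-Catalan numbers *)

(** The coefficient of [t ^ k] in [B ^ r], where [B = 1 + t B ^ m]. The recursion is the sum over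
    [i < r] of [B ^ (i + 1) - B ^ i = t B ^ (i + m)]. *)
Fixpoint raney (m k r : nat) : nat :=
  if k is k'.+1 then (\sum_(i < r) raney m k' (i + m))%N else 1%N.

Arguments raney : simpl never.

Lemma raneyS m k r :
  raney m k.+1 r.+1 = (raney m k.+1 r + raney m k (r + m))%N.
Proof. by rewrite /raney big_ord_recr. Qed.

Lemma raney0 m k : raney m k 0 = (k == 0%N).
Proof. by case: k => //= k; rewrite /raney big_ord0. Qed.

(** Induction on [k], then on [r], through [raneyS]: its two terms have closed forms with the same
    upper index [N = m (k + 1) + r]. *)
Lemma raney_bin m k r : (0 < m)%N ->
  (raney m k r * (m * k + r) = r * 'C(m * k + r, k))%N.
Proof.
move=> m0; elim: k r => [|k IHk] r; first by rewrite muln0 bin0 muln1 /raney mul1n.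
elim: r => [|r IHr]; first by rewrite raney0.
have := IHk (r + m)%N; move: IHr.
rewrite raneyS (_ : (m * k + (r + m) = m * k.+1 + r)%N); last by lia.
rewrite addnS binS; set N := (m * k.+1 + r)%N.
have := mul_bin_left N k; set x := 'C(N, k); set y := 'C(N, k.+1).
have N0 : (0 < N)%N by rewrite /N; lia.
move: (raney m k.+1 r) (raney m k _) => a b xy Ha Hb.
have {Ha Hb} Hab : ((a + b) * N = r * y + (r + m) * x)%N by lia.
apply/eqP; rewrite -(eqn_pmul2l N0); apply/eqP.
have kN : (k <= N)%N by rewrite /N; nia.
suff : (N.+1 * (r * y + (r + m) * x) = N * (r.+1 * (y + x)))%N by nia.
move: xy; rewrite -{1}(subnK kN) => xy.
have NE : (N = m * k.+1 + r)%N by [].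
move: xy; move: (N - k)%N (subnK kN) => d dk; rewrite dk => xy.
(* Multiplication by [k + 1] replaces [binom N (k + 1)] by [(N - k) binom N k / (k + 1)], so that
   both sides become multiples of [binom N k] and a polynomial identity in [d = N - k], [k], [r] and
   [m] remains. *)
apply/eqP; rewrite -(eqn_pmul2l (ltn0Sn k)); apply/eqP.
have -> : (k.+1 * (N.+1 * (r * y + (r + m) * x)) =
  N.+1 * (r * (k.+1 * y) + k.+1 * (r + m) * x))%N by ring.
have -> : (k.+1 * (N * (r.+1 * (y + x))) =
  N * (r.+1 * ((k.+1 * y) + k.+1 * x)))%N by ring.
rewrite xy -dk addnK; have NE2 : (d + k = m * k.+1 + r)%N by lia.

suff : ((d + k).+1 * (r * d + k.+1 * (r + m)) = (d + k) * (r.+1 * (d + k.+1)))%N.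
  move=> e; transitivity ((d + k).+1 * (r * d + k.+1 * (r + m)) * x)%N; first by ring.
  by rewrite e; ring.
have -> : (k.+1 * (r + m) = k * r + (d + k))%N by nia.
by nia.
Qed.

Lemma raney1 m k : (0 < m)%N ->
  (raney m k 1 * ((m - 1) * k + 1) = 'C(m * k, k))%N.
Proof.
move=> m0; have := raney_bin k 1 m0; rewrite mul1n addn1 => H.
have kmk : (k <= m * k)%N by nia.
have := mul_bin_down (m * k).+1 k; rewrite subSn //= -H => e.
apply/eqP; rewrite -(eqn_pmul2l (ltn0Sn (m * k))); apply/eqP.
rewrite e (_ : (m - 1) * k + 1 = (m * k - k).+1)%N; last by nia.
by ring.
Qed.

(** The identity [B ^ r B ^ s = B ^ (r + s)], coefficient by coefficient. *)
Lemma raney_conv m k r s :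
  (\sum_(i < k.+1) raney m i r * raney m (k - i) s = raney m k (r + s))%N.
Proof.
elim: k r => [|k IHk] r; first by rewrite big_ord_recl big_ord0.
elim: r => [|r IHr].
  rewrite big_ord_recl subn0 mul1n big1 ?addn0 // => i _.
  by rewrite raney0 mul0n.
rewrite addSn raneyS -IHr (addnAC r s m) -IHk.
rewrite [LHS]big_ord_recl [X in (_ = X + _)%N]big_ord_recl -addnA.
congr (_ + _)%N; rewrite -big_split /=; apply: eq_bigr => i _.
by rewrite /bump add1n subSS raneyS mulnDl.
Qed.

(** * Power series on a disc *)

Local Open Scope complex_scope.

Local Notation cmod := Normc.normc.
Arguments Normc.normc : simpl never.

(** Each factor [n + 1] is absorbed by a slight increase of the ratio; the midpoint [s] leaves room
    for the remaining [d] factors. *)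
Lemma poly_geometric_bound (R : realType) d (q q' : R) : 0 <= q -> q < q' ->
  exists2 C : R, 0 <= C & forall n : nat, n.+1%:R ^+ d * q ^+ n <= C * q' ^+ n.
Proof.
elim: d q q' => [|d IH] q q' q0 qq'.
  by exists 1 => // n; rewrite expr0 !mul1r lerXn2r ?nnegrE // ?ltW // (le_lt_trans q0).
have q'0 : 0 < q' by exact: le_lt_trans qq'.
pose s := (q + q') / 2; have s0 : 0 < s by rewrite /s; lra.
have [C C0 HC] : exists2 C : R, 0 <= C & forall n : nat, n.+1%:R ^+ d * q ^+ n <= C * s ^+ n.
  by apply: IH => //; rewrite /s; lra.
have [x x0 xs] : exists2 x : R, 0 < x & q' = s * (1 + x).
  exists (q' / s - 1); last by field; rewrite gt_eqF.
  by rewrite subr_gt0 ltr_pdivlMr // mul1r /s; lra.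
(* Bernoulli's inequality, after [n + 1 <= (1 + 1 / x) (1 + n x)]. *)
have bern n : n.+1%:R <= (1 + x^-1) * (1 + x) ^+ n.
  have : 1 + n%:R * x <= (1 + x) ^+ n.
    elim: n => [|n IHn]; first by rewrite mul0r addr0 expr0.
    rewrite exprS -natr1; have n0 : 0 <= n%:R :> R by [].
    have := ler_wpM2l (ltW (ltr_wpDr (ltW x0) ltr01)) IHn; nra.
  move=> H; apply: (@le_trans _ _ ((1 + x^-1) * (1 + n%:R * x))).
    have -> : (1 + x^-1) * (1 + n%:R * x) = 1 + n%:R + (x^-1 + n%:R * x).
      by field; rewrite gt_eqF.
    by rewrite -natr1 addrC lerDl addr_ge0 ?invr_ge0 ?mulr_ge0 // ltW.
  by rewrite ler_wpM2l // addr_ge0 // invr_ge0 ltW.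
exists ((1 + x^-1) * C); first by rewrite mulr_ge0 // addr_ge0 // invr_ge0 ltW.
move=> n; rewrite exprS -mulrA.
apply: (le_trans (ler_wpM2l _ (HC n))) => //.
apply: (le_trans (ler_wpM2r _ (bern n))); first by rewrite mulr_ge0 // exprn_ge0 // ltW.
by rewrite xs [(s * _) ^+ _]exprMn le_eqVlt; apply/orP; left; apply/eqP; ring.
Qed.

Lemma geometric_small (R : realType) (q e : R) : 0 <= q -> q < 1 -> 0 < e ->
  exists n, q ^+ n < e.
Proof.
move=> q0 q1 e0; have /cvgrPdist_lt/(_ e e0) [n _ /(_ n (leqnn _))] :
    (fun n => q ^+ n) @ \oo --> (0 : R).
  by apply: cvg_expr; rewrite ger0_norm.
by rewrite sub0r normrN /= ger0_norm ?exprn_ge0 // => ?; exists n.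
Qed.

Section ComplexModulus.
Variable R : realType.

Lemma cmod_ge0 (z : R[i]) : 0 <= cmod z.
Proof. by case: z => x y; exact: sqrtr_ge0. Qed.

Lemma cmod0 : cmod (0 : R[i]) = 0.
Proof. exact: Normc.normc0. Qed.

Lemma cmod_real (x : R) : cmod (x%:C) = `|x|.
Proof. by rewrite /Normc.normc /= expr0n /= addr0 sqrtr_sqr. Qed.

Lemma cmodX (z : R[i]) n : cmod (z ^+ n) = cmod z ^+ n.
Proof.
elim: n => [|n IH]; first by rewrite !expr0 Normc.normc1.
by rewrite !exprS Normc.normcM IH.
Qed.

Lemma cmod_sum n (F : 'I_n -> R[i]) : cmod (\sum_i F i) <= \sum_i cmod (F i).
Proof.
elim/big_ind2 : _ => //; first by rewrite cmod0.
by move=> x1 x2 y1 y2 H1 H2; rewrite (le_trans (le_normcD _ _)) // lerD.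
Qed.

End ComplexModulus.

Section PowerSeries.
Variables (R : realType) (rho r : R).
Hypotheses (r0 : 0 < r) (rho0 : 0 < rho) (rhor : rho * r < 1).
Implicit Types (f g : R[i] -> R[i]) (a b : nat -> R[i]).

(* [G n] is the remainder [sum_k a (n + k) t ^ k], so that [f] is the sum of
   the power series [a] on the disc of radius [rho]; remainders make products
   and identities of power series accessible without any limit. *)
Definition has_pseries f a :=
  exists (d : nat) (M : R) (G : nat -> R[i] -> R[i]),
    (forall t, cmod t <= rho -> f t = G 0 t) /\
    forall n t, cmod t <= rho ->
      G n t = a n + t * G n.+1 t /\ cmod (G n t) <= M * n.+1%:R ^+ d * r ^+ n.

Lemma has_pseries_ext f g a :
  (forall t, cmod t <= rho -> f t = g t) -> has_pseries f a -> has_pseries g a.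
Proof.
move=> fg [d [M [G [fG H]]]]; exists d, M, G; split=> // t tr.
by rewrite -fg // fG.
Qed.

Lemma has_pseries_extr f a b : a =1 b -> has_pseries f a -> has_pseries f b.
Proof. by move=> /funext ->. Qed.

Lemma has_pseries_cst (c : R[i]) : has_pseries (fun=> c) (fun n => if n is 0 then c else 0).
Proof.
exists 0%N, (cmod c), (fun n _ => if n is 0 then c else 0); split=> // -[|n] t _.
  by rewrite mulr0 addr0 !expr0 !mulr1.
by rewrite mulr0 addr0 cmod0 !mulr_ge0 ?exprn_ge0 ?cmod_ge0 // ltW.
Qed.

Lemma has_pseries_id : has_pseries id (fun n => (n == 1%N)%:R).
Proof.
(* The remainders are [t], [1], [0], ...: the first needs [rho <= M] and the second [1 <= M r]. *)
pose M := Num.max rho r^-1.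
have M0 : 0 <= M by rewrite le_max ltW.
exists 0%N, M, (fun n t => match n with 0 => t | 1 => 1 | _ => 0 end).
split=> // -[|[|n]] t tr /=.
- by rewrite add0r mulr1 !expr0 !mulr1; split=> //; rewrite le_max tr.
- rewrite mulr0 addr0 expr0 expr1 mulr1 Normc.normc1; split=> //.
  by rewrite -[leLHS](@mulVf _ r) ?gt_eqF // ler_wpM2r ?(ltW r0) // /M le_max lexx orbT.
- have rn : 0 <= r ^+ n.+2 by rewrite exprn_ge0 // ltW.
  by rewrite mulr0 addr0 cmod0 expr0 mulr1; split=> //; rewrite mulr_ge0.
Qed.

Lemma has_pseriesD f g a b : has_pseries f a -> has_pseries g b ->
  has_pseries (fun t => f t + g t) (fun n => a n + b n).
Proof.
move=> [d [M [F [fF HF]]]] [d' [M' [G [gG HG]]]].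
exists (d + d')%N, (Num.max 0 M + Num.max 0 M'), (fun n t => F n t + G n t).
split=> [t tr|n t tr]; first by rewrite fF // gG.
have [EF BF] := HF n t tr; have [EG BG] := HG n t tr.
split; first by rewrite EF EG; ring.
have rn : 0 <= r ^+ n by rewrite exprn_ge0 // ltW.
have B (e e' : nat) (N : R) : N * n.+1%:R ^+ e * r ^+ n <=
    Num.max 0 N * n.+1%:R ^+ (e + e') * r ^+ n.
  rewrite ler_wpM2r //; apply: (@le_trans _ _ (Num.max 0 N * n.+1%:R ^+ e)).
    by rewrite ler_wpM2r ?exprn_ge0 // le_max lexx orbT.
  by rewrite ler_wpM2l ?le_max ?lexx // ler_weXn2l ?ler1n // leq_addr.
rewrite !mulrDl; apply: (le_trans (le_normcD _ _)); apply: lerD.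
  exact: le_trans BF (B _ _ _).
by rewrite addnC; exact: le_trans BG (B _ _ _).
Qed.

Lemma has_pseriesM f g a b : has_pseries f a -> has_pseries g b ->
  has_pseries (fun t => f t * g t) (fun n => \sum_(j < n.+1) b j * a (n - j)%N).
Proof.
move=> [d [M [F [fF HF]]]] [d' [M' [G [gG HG]]]].
(* Cut [g] at order [n] and, in the term [b j t ^ j f], cut [f] at order [n - j]: the part divisible
   by [t ^ n] gives this remainder. Its [n + 1] summands raise the polynomial degree of the bound by
   one. *)
exists (d + d').+1, (M * M'),
  (fun n t => F 0 t * G n t + \sum_(j < n) b j * F (n - j)%N t).
have b_bound j : cmod (b j) <= M' * j.+1%:R ^+ d' * r ^+ j.
  have [] := HG j 0; first by rewrite cmod0 ltW.
  by rewrite mul0r addr0 => ->.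
have M'0 : 0 <= M'.
  by have := b_bound 0%N; rewrite expr1n expr0 !mulr1; apply: le_trans; exact: cmod_ge0.
have M0 : 0 <= M.
  have [|_] := HF 0 0; first by rewrite cmod0 ltW.
  by rewrite expr1n expr0 !mulr1; apply: le_trans; exact: cmod_ge0.
split=> [t tr|n t tr]; first by rewrite big_ord0 addr0 fF // gG.
split.
  have [EF _] := HF 0 t tr; have [EG _] := HG n t tr.
  rewrite 2!big_ord_recr /= subnn subSnn.
  rewrite EG mulrDr {1}EF.
  have -> : \sum_(j < n) b j * F (n - j)%N t =
      \sum_(j < n) b j * a (n - j)%N + t * \sum_(j < n) b j * F (n.+1 - j)%N t.
    rewrite mulr_sumr -big_split; apply: eq_bigr => j _ /=.
    by have [-> _] := HF (n - j)%N t tr; rewrite subSn ?(ltnW (ltn_ord j)) //; ring.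
  by ring.
have rn : 0 <= r ^+ n by rewrite exprn_ge0 // ltW.
apply: (le_trans (le_normcD _ _)).
have K : forall j, (j <= n)%N -> forall x y, cmod x <= M * (n - j).+1%:R ^+ d * r ^+ (n - j) ->
    cmod y <= M' * j.+1%:R ^+ d' * r ^+ j ->
    cmod (y * x) <= M * M' * n.+1%:R ^+ (d + d') * r ^+ n.
  move=> j jn x y Hx Hy; rewrite Normc.normcM.
  apply: (le_trans (ler_pM (cmod_ge0 _) (cmod_ge0 _) Hy Hx)).
  have -> : r ^+ n = r ^+ (n - j) * r ^+ j by rewrite -exprD subnK.
  rewrite exprD.
  have A : (n - j).+1%:R ^+ d <= n.+1%:R ^+ d :> R.
    by rewrite lerXn2r ?nnegrE // ler_nat ltnS leq_subr.
  have B : j.+1%:R ^+ d' <= n.+1%:R ^+ d' :> R by rewrite lerXn2r ?nnegrE // ler_nat.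
  have -> : M' * j.+1%:R ^+ d' * r ^+ j * (M * (n - j).+1%:R ^+ d * r ^+ (n - j)) =
    (M * M' * (r ^+ (n - j) * r ^+ j)) * ((n - j).+1%:R ^+ d * j.+1%:R ^+ d') by ring.
  rewrite [leRHS](_ : _ = (M * M' * (r ^+ (n - j) * r ^+ j)) * (n.+1%:R ^+ d * n.+1%:R ^+ d')); last by ring.
  by rewrite ler_wpM2l ?mulr_ge0 ?exprn_ge0 ?(ltW r0) // ler_pM ?exprn_ge0.
have -> : M * M' * n.+1%:R ^+ (d + d').+1 * r ^+ n =
    M * M' * n.+1%:R ^+ (d + d') * r ^+ n + n%:R * (M * M' * n.+1%:R ^+ (d + d') * r ^+ n).
  by rewrite exprS -natr1; ring.
apply: lerD.
  rewrite mulrC; apply: (K n) => //; last by have [] := HG n t tr.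
  by rewrite subnn; have [] := HF 0 t tr.
apply: (le_trans (cmod_sum _)).
have -> : n%:R * (M * M' * n.+1%:R ^+ (d + d') * r ^+ n) =
    \sum_(j < n) (M * M' * n.+1%:R ^+ (d + d') * r ^+ n).
  by rewrite sumr_const card_ord mulr_natl.
apply: ler_sum => j _; apply: (K j); rewrite ?(ltnW (ltn_ord j)) //.
by have [] := HF (n - j)%N t tr.
Qed.

(** With zero coefficients [f t = t ^ n F n t] for every [n], and the remainder bound makes this
    [O((n + 1) ^ d (rho r) ^ n)], which tends to 0. *)
Lemma pseries_id0 f a : has_pseries f a -> (forall n, a n = 0) ->
  forall t, cmod t <= rho -> f t = 0.
Proof.
move=> [d [M [F [fF HF]]]] a0 t tr.
have Ft n : f t = t ^+ n * F n t.
  elim: n => [|n ->]; first by rewrite mul1r fF.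
  by have [-> _] := HF n t tr; rewrite a0 add0r exprSr mulrA.
apply: Normc.eq0_normc; apply/eqP; rewrite eq_le cmod_ge0 andbT leNgt.
apply/negP => ft0.
have rr0 : 0 <= rho * r by rewrite mulr_ge0 // ltW.
pose q := (rho * r + 1) / 2.
have rr1 : rho * r < 1 := rhor.
have [q0 q1 rq] : [/\ 0 <= q, q < 1 & rho * r < q] by split; rewrite /q; lra.
have [C C0 HC] := poly_geometric_bound d rr0 rq.
have MC : 0 < Num.max 1 M * C + 1.
  by rewrite ltr_wpDl // mulr_ge0 // le_max ler01.
have [n] := geometric_small q0 q1 (divr_gt0 ft0 MC).
rewrite ltr_pdivlMr // => qn.
suff H : cmod (f t) <= q ^+ n * (Num.max 1 M * C + 1).
  by have := le_lt_trans H qn; rewrite ltxx.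
rewrite (Ft n) Normc.normcM cmodX; have [_ B] := HF n t tr.
have tn : cmod t ^+ n <= rho ^+ n by rewrite lerXn2r ?nnegrE ?cmod_ge0 // ltW.
apply: (le_trans (ler_pM _ (cmod_ge0 _) tn B)); first by rewrite exprn_ge0 ?cmod_ge0.
have -> : rho ^+ n * (M * n.+1%:R ^+ d * r ^+ n) = M * (n.+1%:R ^+ d * (rho * r) ^+ n).
  by rewrite exprMn; ring.
have A0 : 0 <= n.+1%:R ^+ d * (rho * r) ^+ n by rewrite mulr_ge0 ?exprn_ge0.
apply: (@le_trans _ _ (Num.max 1 M * (C * q ^+ n))).
  apply: (@le_trans _ _ (Num.max 1 M * (n.+1%:R ^+ d * (rho * r) ^+ n))).
    by rewrite ler_wpM2r // le_max lexx orbT.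
  by rewrite ler_wpM2l ?HC // le_max ler01.
rewrite mulrA [leRHS]mulrC ler_wpM2r ?exprn_ge0 //; lra.
Qed.

(** If [F n] vanishes near 0 off 0, then [a n = - t F (n + 1) t] there, with [F (n + 1)] bounded, so
    [a n = 0] and then [F (n + 1)] vanishes there too. The point 0 is left out because [t] stands
    for the inverse of a complex number. *)
Lemma pseries_coef0 f a e : 0 < e -> has_pseries f a ->
  (forall t, cmod t < e -> t != 0 -> f t = 0) -> forall n, a n = 0.
Proof.
move=> e0 [d [M [F [fF HF]]]] f0.
pose e1 := Num.min e rho.
have e10 : 0 < e1 by rewrite lt_min e0.
have step n : (forall t, cmod t < e1 -> t != 0 -> F n t = 0) -> a n = 0.
  move=> Fn0; apply: Normc.eq0_normc; apply/eqP; rewrite eq_le cmod_ge0 andbT leNgt.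
  apply/negP => an0; set B := M * n.+2%:R ^+ d * r ^+ n.+1.
  (* At the real point [t = s] the product [t F (n + 1) t] has modulus at most [cmod (a n) / 2],
     against [a n = - t F (n + 1) t]. *)
  pose s := Num.min (e1 / 2) (cmod (a n) / (Num.max 0 B + 1) / 2).
  have B0 : 0 < Num.max 0 B + 1 by rewrite ltr_wpDl // le_max lexx.
  have s0 : 0 < s by rewrite lt_min !divr_gt0.
  have cs : cmod s%:C = s by rewrite cmod_real gtr0_norm.
  have se : s < e1 by rewrite gt_min; apply/orP; left; lra.
  have sr : s < rho by rewrite (lt_le_trans se) // ge_min lexx orbT.
  have sn0 : s%:C != 0 :> R[i] by rewrite -(rmorph0 (real_complex R)) (inj_eq (@complexI R)) gt_eqF.
  have [] := HF n s%:C; first by rewrite cs ltW.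
  rewrite Fn0 ?cs // => /eqP; rewrite eq_sym addr_eq0 => /eqP an _.
  have csr : cmod s%:C <= rho by rewrite cs ltW.
  have [_ HB] := HF n.+1 _ csr.
  have : cmod (a n) <= s * (Num.max 0 B + 1).
    rewrite an normcN Normc.normcM cs ler_wpM2l ?(ltW s0) //.
    by rewrite (le_trans HB) // ler_wpDr // le_max lexx orbT.
  have : s * (Num.max 0 B + 1) <= cmod (a n) / 2.
    rewrite -ler_pdivlMr // (_ : _ / _ = cmod (a n) / (Num.max 0 B + 1) / 2); last by field; rewrite gt_eqF.
    by rewrite ge_min lexx orbT.
  by lra.
have Fn0 n : forall t, cmod t < e1 -> t != 0 -> F n t = 0.
  elim: n => [|n IH] t; rewrite lt_min => /andP[te tr] t0; first by rewrite -fF ?f0 // ltW.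
  have [] := HF n t (ltW tr); rewrite IH ?lt_min ?te // step // add0r => /esym/eqP.
  by rewrite mulf_eq0 (negPf t0) => /eqP.
by move=> n; apply/step/Fn0.
Qed.
End PowerSeries.

(** * Expectation of complex functions on the plane *)

(** Inversion, whose value at 0 is 0 by convention, is treated separately on the point 0 and on its
    open complement, where it is continuous. *)
Lemma measurable_funVr d (T : measurableType d) (R : realType) (f : T -> R) :
  measurable_fun setT f -> measurable_fun setT (fun x => (f x)^-1).
Proof.
move=> mf; apply: (measurableT_comp _ mf).
have -> : [set: R] = [set 0] `|` ~` [set 0] by rewrite setUv.
have m0 : measurable [set 0 : R] by [].
apply/measurable_funU; [by []|exact: measurableC|split].
  exact: measurable_fun_set1.
apply: open_continuous_measurable_fun; first by rewrite openC; exact: closed_eq.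
move=> x; rewrite inE /= => /eqP x0; exact: inv_continuous.
Qed.

(** The sigma-algebra on the plane is a product; an open set is the union of the countably many
    boxes with rational ends that it contains. *)
Lemma open_measurable_plane (R : realType) (U : set (R * R)) :
  open U -> measurable U.
Proof.
move=> oU.
pose box (q : (rat * rat) * (rat * rat)) : set (R * R) :=
  `]ratr q.1.1, ratr q.1.2[%classic `*` `]ratr q.2.1, ratr q.2.2[%classic.
have -> : U = \bigcup_(q in [set q | box q `<=` U]) box q.
  apply/seteqP; split=> [[x y] Uxy|p [q qU]]; last exact: qU.
  have [[A B] [/= [e1 /= e10 A1] [e2 /= e20 B1]] AB] := oU _ Uxy.
  have rbox (z e : R) : 0 < e -> exists q q' : rat,
      [/\ ratr q < z, z < ratr q' & forall t, ratr q < t < ratr q' -> `|z - t| < e].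
    move=> e0; have [q] := @rat_in_itvoo R (z - e) z ltac:(by lra).
    have [q'] := @rat_in_itvoo R z (z + e) ltac:(by lra).
    rewrite !in_itv /= => /andP[q1 q2] /andP[q3 q4]; exists q, q'; split=> // t /andP[? ?].
    by rewrite ltr_norml; apply/andP; split; lra.
  have [q1 [q2 [h1 h2 h3]]] := rbox x _ e10.
  have [q3 [q4 [h4 h5 h6]]] := rbox y _ e20.
  exists ((q1, q2), (q3, q4)); last by split; rewrite /= in_itv /= ?h1 ?h4.
  move=> [s t] [/=]; rewrite !in_itv /= => hs ht; apply: AB; split=> /=.
    by apply: A1 => /=; exact: h3.
  by apply: B1 => /=; exact: h6.
rewrite bigcup_mkcond; apply: countable_bigcupT_measurable; first exact: countableP.
move=> q; case: ifP => _ //; exact: measurableX.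
Qed.

Section ComplexExpectation.
Variable R : realType.
Implicit Types (f g h : plane R -> R[i]).

Definition cmeasurable h :=
  measurable_fun setT (fun p => complex.Re (h p)) /\
  measurable_fun setT (fun p => complex.Im (h p)).

Lemma cmeasurable_cst (c : R[i]) : cmeasurable (fun=> c).
Proof. by split; exact: measurable_cst. Qed.

Lemma cmeasurable_toC : cmeasurable (@toC R).
Proof. by split; [exact: measurable_fst | exact: measurable_snd]. Qed.

Lemma cmeasurableD f g : cmeasurable f -> cmeasurable g ->
  cmeasurable (fun p => f p + g p).
Proof.
move=> [f1 f2] [g1 g2]; split.
  by apply: eq_measurable_fun (measurable_funD f1 g1) => p _; rewrite raddfD.
by apply: eq_measurable_fun (measurable_funD f2 g2) => p _; rewrite raddfD.
Qed.

Lemma cmeasurableM f g : cmeasurable f -> cmeasurable g ->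
  cmeasurable (fun p => f p * g p).
Proof.
move=> [f1 f2] [g1 g2]; split.
  apply: eq_measurable_fun
    (measurable_funB (measurable_funM f1 g1) (measurable_funM f2 g2)) => p _.
  by move=> /=; case: (f p) => a b; case: (g p) => c d.
apply: eq_measurable_fun
  (measurable_funD (measurable_funM f1 g2) (measurable_funM f2 g1)) => p _.
by move=> /=; case: (f p) => a b; case: (g p) => c d.
Qed.

Lemma cmeasurableB f g : cmeasurable f -> cmeasurable g ->
  cmeasurable (fun p => f p - g p).
Proof.
move=> mf mg; have := cmeasurableD mf (cmeasurableM (cmeasurable_cst (-1)) mg).
by under eq_fun do rewrite mulN1r.
Qed.

Lemma cmeasurableX f n : cmeasurable f -> cmeasurable (fun p => f p ^+ n).
Proof.
move=> mf; elim: n => [|n IH]; first exact: cmeasurable_cst.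
by under eq_fun do rewrite exprS; exact: cmeasurableM.
Qed.

Lemma cmeasurableV f : cmeasurable f -> cmeasurable (fun p => (f p)^-1).
Proof.
move=> [f1 f2].
have mN := measurable_funVr
  (measurable_funD (measurable_funM f1 f1) (measurable_funM f2 f2)).
split.
  apply: eq_measurable_fun (measurable_funM f1 mN) => p _ /=.
  by case: (f p) => a b /=; rewrite !expr2.
have mN1 := measurable_funM (@measurable_cst _ _ _ _ setT (-1 : R)) (measurable_funM f2 mN).
apply: eq_measurable_fun mN1 => p _ /=.
by case: (f p) => a b /=; rewrite !expr2 mulN1r -mulNr.
Qed.

Lemma Re_bound (z : R[i]) : `|complex.Re z| <= cmod z.
Proof.
case: z => a b /=; rewrite /Normc.normc -sqrtr_sqr ler_wsqrtr // lerDl sqr_ge0 //.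
Qed.

Lemma Im_bound (z : R[i]) : `|complex.Im z| <= cmod z.
Proof.
case: z => a b /=; rewrite /Normc.normc -sqrtr_sqr ler_wsqrtr // lerDr sqr_ge0 //.
Qed.

Lemma cmod_le_ReIm (z : R[i]) : cmod z <= `|complex.Re z| + `|complex.Im z|.
Proof.
case: z => a b /=.
have -> : a +i* b = a%:C + 'i%C * b%:C by rewrite [LHS]complexE.
apply: (le_trans (le_normcD _ _)).
rewrite Normc.normcM !cmod_real (_ : cmod 'i%C = 1) ?mul1r //.
by rewrite /Normc.normc /= expr0n expr1n add0r sqrtr1.
Qed.

Variables (mu : probability (plane R) R) (S : set (plane R)).
Hypotheses (mS : measurable S) (muS : mu (~` S) = 0%E).

Definition cint h : R[i] :=
  (\int[mu]_p complex.Re (h p)) +i* (\int[mu]_p complex.Im (h p)).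

(** The bound is asked on [S] alone, which carries [mu]: kernels such as [1 / (z - p)] are not
    bounded on the whole plane. *)
Definition cbounded h M := cmeasurable h /\ forall p, S p -> cmod (h p) <= M.

Lemma cboundedD f g M N : cbounded f M -> cbounded g N ->
  cbounded (fun p => f p + g p) (M + N).
Proof.
move=> [mf fM] [mg gN]; split=> [|p Sp]; first exact: cmeasurableD.
by rewrite (le_trans (le_normcD _ _)) // lerD ?fM ?gN.
Qed.

Lemma cboundedZ (c : R[i]) f M : cbounded f M ->
  cbounded (fun p => c * f p) (cmod c * M).
Proof.
move=> [mf fM]; split=> [|p Sp].
  by apply: cmeasurableM => //; exact: cmeasurable_cst.
by rewrite Normc.normcM ler_wpM2l ?cmod_ge0 ?fM.
Qed.

Lemma bounded_integrable_on (f : plane R -> R) M : measurable_fun setT f ->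
  (forall p, S p -> `|f p| <= M) -> mu.-integrable setT (EFin \o f).
Proof.
move=> mf fM; apply/(@negligible_integrable _ _ _ mu setT (~` S)) => //.
- exact: measurableC.
- exact/measurable_EFinP.
rewrite setTD setCK; apply: measurable_bounded_integrable => //.
- by rewrite (le_lt_trans (probability_le1 mu mS)) // ltry.
- exact: measurable_funTS.
exists M; split; first exact: num_real.
move=> x Mx p Sp /=; by rewrite (le_trans (fM p Sp)) // ltW.
Qed.

Lemma Rintegral_on (f : plane R -> R) M : measurable_fun setT f ->
  (forall p, S p -> `|f p| <= M) -> \int[mu]_p f p = \int[mu]_(p in S) f p.
Proof.
move=> mf fM; rewrite /Rintegral (@negligible_integral _ _ _ mu setT (~` S)) //.
- by rewrite setTD setCK.
- exact: measurableC.
- exact: bounded_integrable_on fM.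
Qed.

Lemma Rintegral_bound (f : plane R -> R) M : measurable_fun setT f ->
  (forall p, S p -> `|f p| <= M) -> `|\int[mu]_p f p| <= M.
Proof.
move=> mf fM; have fi := bounded_integrable_on mf fM.
have fiS : mu.-integrable S (EFin \o f) by apply: integrableS fi.
rewrite (Rintegral_on mf fM); apply: (le_trans (le_normr_Rintegral _ _)) => //.
have muS1 : mu S = 1%E.
  have := probability_setC mu mS; rewrite muS => /esym/eqP.
  by rewrite sube_eq ?add0e // ?fin_num_measure // => /eqP.
apply: (@le_trans _ _ (\int[mu]_(p in S) M)); last first.
  by rewrite Rintegral_cst // [X in fine X](_ : _ = 1%E) ?mulr1 //; exact: muS1.
apply: le_Rintegral => //.
- exact: integrable_norm fiS.
- apply: measurable_bounded_integrable => //.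
    by rewrite (le_lt_trans (probability_le1 mu mS)) // ltry.
  exists `|M|; split; first exact: num_real.
  by move=> x Mx p _ /=; rewrite ltW.
Qed.

Lemma cbounded_integrable h M : cbounded h M ->
  mu.-integrable setT (EFin \o (fun p => complex.Re (h p))) /\
  mu.-integrable setT (EFin \o (fun p => complex.Im (h p))).
Proof.
move=> [[h1 h2] hM]; split.
  by apply: (bounded_integrable_on h1) => p /hM; exact: le_trans (Re_bound _).
by apply: (bounded_integrable_on h2) => p /hM; exact: le_trans (Im_bound _).
Qed.

(** The factor 2 comes from bounding the real and imaginary parts separately; only the order of
    magnitude matters later. *)
Lemma cint_bound h M : cbounded h M -> cmod (cint h) <= 2 * M.
Proof.
move=> [[h1 h2] hM]; rewrite (le_trans (cmod_le_ReIm _)) //= mulrDl mul1r lerD //.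
  by apply: (Rintegral_bound h1) => p /hM; exact: le_trans (Re_bound _).
by apply: (Rintegral_bound h2) => p /hM; exact: le_trans (Im_bound _).
Qed.

Lemma cint_cst (c : R[i]) : cint (fun=> c) = c.
Proof.
have E (r : R) : \int[mu]_p r = r.
  by rewrite Rintegral_cst // [X in fine X](_ : _ = 1%E) ?mulr1 //; exact: probability_setT.
by rewrite /cint !E; case: c.
Qed.

Lemma cintD f g M N : cbounded f M -> cbounded g N ->
  cint (fun p => f p + g p) = cint f + cint g.
Proof.
move=> /cbounded_integrable[f1 f2] /cbounded_integrable[g1 g2].
rewrite /cint; under eq_Rintegral do rewrite raddfD.
under [X in _ +i* X]eq_Rintegral do rewrite raddfD.
by rewrite !RintegralD.
Qed.

Lemma cintZ (c : R[i]) f M : cbounded f M -> cint (fun p => c * f p) = c * cint f.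
Proof.
move=> fM; have [f1 f2] := cbounded_integrable fM.
have I (a : R) (u : plane R -> R) : mu.-integrable setT (EFin \o u) ->
    mu.-integrable setT (EFin \o (fun p => a * u p)).
  by move=> ui; have := integrableZl measurableT a ui; apply: eq_integrable.
rewrite /cint; case: c => a b.
have -> : \int[mu]_p complex.Re ((a +i* b) * f p) =
    \int[mu]_p (a * complex.Re (f p) - b * complex.Im (f p)).
  by apply: eq_Rintegral => p _; case: (f p).
have -> : \int[mu]_p complex.Im ((a +i* b) * f p) =
    \int[mu]_p (a * complex.Im (f p) + b * complex.Re (f p)).
  by apply: eq_Rintegral => p _; case: (f p).
by rewrite RintegralB ?RintegralD ?RintegralZl //; do 1?exact: I.
Qed.

Lemma cint_eq f g M : cbounded f M -> cmeasurable g ->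
  (forall p, S p -> f p = g p) -> cint f = cint g.
Proof.
move=> [[f1 f2] fM] [g1 g2] fg; rewrite /cint.
rewrite (@Rintegral_on _ M f1) ?(@Rintegral_on _ M f2) ?(@Rintegral_on _ M g1)
  ?(@Rintegral_on _ M g2) => [||||]; try by move=> p Sp; rewrite -?fg //;
   apply: le_trans (fM _ Sp); rewrite ?Re_bound ?Im_bound.
by congr (_ +i* _); apply: eq_Rintegral => p; rewrite inE => Sp; rewrite fg.
Qed.

End ComplexExpectation.

(** * Cauchy transforms *)

Section RaneySeries.
Variables (R : realType) (rho r : R) (m : nat) (f : R[i] -> R[i]).
Hypotheses (r0 : 0 < r) (rho0 : 0 < rho) (rhor : rho * r < 1).
Hypothesis fS : has_pseries rho r f (fun k => (raney m k 1)%:R).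

Lemma has_pseries_exp n :
  has_pseries rho r (fun t => f t ^+ n) (fun k => (raney m k n)%:R).
Proof.
elim: n => [|n IH].
  apply: (@has_pseries_ext _ _ _ (fun=> 1)) => [t _|]; first by rewrite expr0.
  by apply: (has_pseries_extr _ (has_pseries_cst rho r0 1)) => -[|k]; rewrite raney0.
apply: (@has_pseries_ext _ _ _ (fun t => f t * f t ^+ n)).
  by move=> t _; rewrite exprS.
apply: (has_pseries_extr _ (has_pseriesM r0 rho0 fS IH)) => k.
rewrite -(addn1 n) -raney_conv natr_sum.
by apply: eq_bigr => j _; rewrite natrM.
Qed.

(** All coefficients of [f - (1 + t f ^ m)] vanish: that of [t ^ (k + 1)] in [t f ^ m] is
    [raney m k m], which is [raney m k.+1 1] by [raneyS]. *)
Lemma raney_series_eq t : cmod t <= rho -> f t = 1 + t * f t ^+ m.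
Proof.
move=> tr; apply/eqP; rewrite -subr_eq0; apply/eqP.
have S1 := has_pseriesM r0 rho0 (has_pseries_id r0 rho0) (has_pseries_exp m).
have S2 := has_pseriesD r0 (has_pseries_cst rho r0 1) S1.
have S3 := has_pseriesM r0 rho0 (has_pseries_cst rho r0 (-1)) S2.
have S4 := has_pseriesD r0 fS S3.
suff E : f t + -1 * (1 + t * f t ^+ m) = 0 by rewrite -E mulN1r.
apply: (pseries_id0 r0 rho0 rhor S4) tr => k.
rewrite big_ord_recr /= subnn big1 => [|j _]; last first.
  by rewrite -subnSK ?ltn_ord // mulr0.
rewrite add0r mulrN1.
case: k => [|k].
  by rewrite big_ord_recr big_ord0 /= mulr0 !addr0 subrr.
rewrite 2!big_ord_recr /= subnn subSnn mulr0 addr0 mulr1.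
rewrite big1 => [|j _]; last first.
  by rewrite subSn ?(ltnW (ltn_ord j)) // -subnSK ?ltn_ord // mulr0.
by rewrite !add0r raneyS raney0 /= add0n subrr.
Qed.

End RaneySeries.

Section CauchyTransform.
Variables (R : realType) (mu : probability (plane R) R) (S : set (plane R)).
Hypotheses (mS : measurable S) (muS : mu (~` S) = 0%E).

Lemma cauchy_cint z : cauchy_transform mu z = cint mu (fun p => (z - toC p)^-1).
Proof. by []. Qed.

Lemma cmeasurable_kernel (c t : R[i]) n :
  cmeasurable (fun p : plane R => (toC p - c) ^+ n / (1 - (toC p - c) * t)).
Proof.
have mc := cmeasurableB (cmeasurable_toC R) (cmeasurable_cst c).
apply: cmeasurableM; first exact: cmeasurableX.
apply: cmeasurableV; apply: cmeasurableB; first exact: cmeasurable_cst.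
by apply: cmeasurableM => //; exact: cmeasurable_cst.
Qed.

Lemma cmodB_ge (x y : R[i]) : cmod x - cmod y <= cmod (x - y).
Proof.
by rewrite lerBlDr; apply: le_trans (le_normcD _ _); rewrite subrK.
Qed.

(** The geometric series, integrated. With [x = p - c], the remainders are the integrals of
    [x ^ n / (1 - x t)], whose denominator is at least [1 - rho r] in modulus. *)
Lemma kernel_series (c : R[i]) rho r : 0 < r -> 0 < rho -> rho * r < 1 ->
  (forall p, S p -> cmod (toC p - c) <= r) ->
  has_pseries rho r (fun t => cint mu (fun p => (1 - (toC p - c) * t)^-1))
    (fun n => cint mu (fun p => (toC p - c) ^+ n)).
Proof.
move=> r0 rho0 rhor Sr.
exists 0%N, (2 / (1 - rho * r)),
  (fun n t => cint mu (fun p => (toC p - c) ^+ n / (1 - (toC p - c) * t))).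
split=> [t _|n t tr].
  by congr cint; apply/funext => p; rewrite mul1r.
have q0 : 0 < 1 - rho * r by rewrite subr_gt0.
have den p : S p -> 1 - rho * r <= cmod (1 - (toC p - c) * t).
  move=> Sp; apply: le_trans (cmodB_ge _ _).
  rewrite Normc.normc1 lerB // Normc.normcM mulrC ler_pM ?cmod_ge0 // Sr //.
have bX k p : S p -> cmod ((toC p - c) ^+ k) <= r ^+ k.
  by move=> Sp; rewrite cmodX lerXn2r ?nnegrE ?cmod_ge0 ?Sr // ltW.
have bk k : cbounded S (fun p => (toC p - c) ^+ k / (1 - (toC p - c) * t))
    (r ^+ k / (1 - rho * r)).
  split=> [|p Sp]; first exact: cmeasurable_kernel.
  rewrite Normc.normcM Normc.normcV ler_pM ?cmod_ge0 ?invr_ge0 ?cmod_ge0 ?bX //.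
  by rewrite lef_pV2 ?posrE ?den // (lt_le_trans q0) // den.
have mX k : cmeasurable (fun p : plane R => (toC p - c) ^+ k).
  apply: cmeasurableX; apply: cmeasurableB; first exact: cmeasurable_toC.
  exact: cmeasurable_cst.
split; last first.
  rewrite expr0 mulr1 (_ : _ * r ^+ n = 2 * (r ^+ n / (1 - rho * r))); last by ring.
  exact: (cint_bound mS muS (bk n)).
rewrite -(cintZ mS muS t (bk n.+1)).
have bZ : cbounded S (fun p => t * ((toC p - c) ^+ n.+1 / (1 - (toC p - c) * t)))
    (cmod t * (r ^+ n.+1 / (1 - rho * r))).
  have [m1 m2] := bk n.+1; split; first by apply: cmeasurableM; [exact: cmeasurable_cst|].
  by move=> p Sp; rewrite Normc.normcM ler_wpM2l ?cmod_ge0 ?m2.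
rewrite -(cintD mS muS (conj (mX n) (bX n)) bZ).
have [m1 _] := bk n; have [m2 _] := bZ.
apply: (cint_eq mS muS (bk n)); first exact: cmeasurableD.
move=> p Sp; have d0 : 1 - (toC p - c) * t != 0.
  apply/eqP => E; have := den p Sp; rewrite E cmod0 => /(lt_le_trans q0).
  by rewrite ltxx.
by move: (toC p - c) d0 => x d0; rewrite exprS; field.
Qed.

Lemma kernel_bounded (c z : R[i]) r : 0 < r -> r < cmod (z - c) ->
  (forall p, S p -> cmod (toC p - c) <= r) ->
  cbounded S (fun p => (1 - (toC p - c) * (z - c)^-1)^-1)
    (1 - r / cmod (z - c))^-1.
Proof.
move=> r0 rz Sr; have zc0 : 0 < cmod (z - c) := lt_trans r0 rz.
have q0 : 0 < 1 - r / cmod (z - c) by rewrite subr_gt0 ltr_pdivrMr // mul1r.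
split=> [|p Sp].
  have := cmeasurable_kernel c (z - c)^-1 0.
  by under eq_fun do rewrite mul1r.
have den : 1 - r / cmod (z - c) <= cmod (1 - (toC p - c) * (z - c)^-1).
  apply: le_trans (cmodB_ge _ _).
  rewrite Normc.normc1 lerB // Normc.normcM Normc.normcV ler_pM2r ?invr_gt0 //.
  exact: Sr.
by rewrite Normc.normcV lef_pV2 ?posrE // (lt_le_trans q0).
Qed.

Lemma cauchy_kernel (c z : R[i]) r : 0 < r -> r < cmod (z - c) ->
  (forall p, S p -> cmod (toC p - c) <= r) ->
  cauchy_transform mu z =
  (z - c)^-1 * cint mu (fun p => (1 - (toC p - c) * (z - c)^-1)^-1).
Proof.
move=> r0 rz Sr; rewrite cauchy_cint -(cintZ mS muS _ (kernel_bounded r0 rz Sr)).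
congr cint; apply/funext => p; rewrite -invfM mulrBr mulr1 mulrCA divff ?mulr1.
  by congr (_^-1); ring.
by apply/eqP => E; move: rz; rewrite E cmod0 => /(lt_trans r0); rewrite ltxx.
Qed.

End CauchyTransform.

(** * Continuation of the algebraic equation from a neighbourhood of infinity *)

Section AlgebraicContinuation.
Variables (R : realType) (mu : probability (plane R) R) (S : set (plane R)).
Hypotheses (mS : measurable S) (muS : mu (~` S) = 0%E).
Variables (K : R) (m : nat).
Hypotheses (K0 : 0 < K) (SK : forall p, S p -> cmod (toC p) <= K).
Hypothesis moments :
  forall n, cint mu (fun p => toC p ^+ n) = (raney m n 1)%:R.

Local Notation C := (cauchy_transform mu).

(** With [t = 1 / z], the product [z C z] is the moment series in [t], to which [raney_series_eq]
    applies. *)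
Lemma cauchy_eq_exterior z : K < cmod z -> (z * C z) ^+ m = z * (z * C z - 1).
Proof.
move=> Kz; have z0 : 0 < cmod z := lt_trans K0 Kz.
have zn0 : z != 0 by apply: contraTN z0 => /eqP ->; rewrite cmod0 ltxx.
have SK0 p : S p -> cmod (toC p - 0) <= K by rewrite subr0; exact: SK.
have rho0 : 0 < (cmod z)^-1 by rewrite invr_gt0.
have rhoK : (cmod z)^-1 * K < 1 by rewrite mulrC ltr_pdivrMr // mul1r.
have := kernel_series mS muS K0 rho0 rhoK SK0.
move=> /(has_pseries_extr (b := fun k => (raney m k 1)%:R)) [].
  by move=> n; rewrite -moments; congr cint; apply/funext => p; rewrite subr0.
move=> d H; have {}H : has_pseries (cmod z)^-1 K
    (fun t => cint mu (fun p => (1 - (toC p - 0) * t)^-1)) (fun k => (raney m k 1)%:R).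
  by exists d.
have := @raney_series_eq _ _ _ _ _ K0 rho0 rhoK H z^-1.
rewrite Normc.normcV lexx => /(_ isT).
have -> : C z = z^-1 * cint mu (fun p => (1 - (toC p - 0) * z^-1)^-1).
  have Kz0 : K < cmod (z - 0) by rewrite subr0.
  by rewrite (cauchy_kernel mS muS K0 Kz0 SK0) subr0.
by move: (cint _ _) => U HU; rewrite mulrA divff // mul1r {2}HU; field.
Qed.

(** In the variable [t = 1 / (z - c)] the difference of the two sides, times [t], is one power
    series on a disc that contains the given point. It vanishes for small nonzero [t] by
    [cauchy_eq_exterior], hence everywhere on that disc. *)
Lemma cauchy_eq_disc c r z : 0 < r -> r < cmod (z - c) ->
  (forall p, S p -> cmod (toC p - c) <= r) ->
  (z * C z) ^+ m = z * (z * C z - 1).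
Proof.
move=> r0 rz Sr; have zc0 : 0 < cmod (z - c) := lt_trans r0 rz.
have zcn0 : z - c != 0 by apply: contraTN zc0 => /eqP ->; rewrite cmod0 ltxx.
set rho := (cmod (z - c))^-1.
have rho0 : 0 < rho by rewrite invr_gt0.
have rhor : rho * r < 1 by rewrite mulrC ltr_pdivrMr // mul1r.
set U := fun t => cint mu (fun p => (1 - (toC p - c) * t)^-1).
have [a HU] : exists a, has_pseries rho r U a.
  by eexists; exact: (kernel_series mS muS r0 rho0 rhor Sr).
have cst k := has_pseries_cst rho r0 k.
have id := has_pseries_id r0 rho0.
have H1 := has_pseriesD r0 (cst 1) (has_pseriesM r0 rho0 (cst c) id).
have Hu := has_pseriesM r0 rho0 H1 HU.
have [b Hum] : exists b, has_pseries rho r (fun t => ((1 + c * t) * U t) ^+ m) b.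
  elim: (m) => [|n [b Hb]]; first by eexists; exact: cst.
  eexists; apply: (@has_pseries_ext _ _ _ (fun t => ((1 + c * t) * U t) * ((1 + c * t) * U t) ^+ n)).
    by move=> t _; rewrite exprS.
  exact: (has_pseriesM r0 rho0 Hu Hb).
(* With [z = c + 1 / t] one has [z t = 1 + c t], and [u = (1 + c t) U t] is [z C z]. The series is
   that of [t u ^ m - (1 + c t) (u - 1)], that is, [t (u ^ m - z (u - 1))]. *)
have HH := has_pseriesD r0 (has_pseriesM r0 rho0 id Hum)
  (has_pseriesM r0 rho0 (cst (-1)) (has_pseriesM r0 rho0 H1 (has_pseriesD r0 Hu (cst (-1))))).
(* For [0 < cmod t < e] the point [y = c + 1 / t] lies outside both the disc of centre [c] and
   radius [r] and the disc of centre 0 and radius [K]. *)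
pose e := (K + cmod c + r + 1)^-1.
have e10 : 0 < K + cmod c + r + 1.
  by have := cmod_ge0 c; have := K0; have := r0; lra.
have e0 : 0 < e by rewrite invr_gt0.
have H0 : forall t, cmod t < e -> t != 0 ->
    t * ((1 + c * t) * U t) ^+ m + -1 * ((1 + c * t) * ((1 + c * t) * U t + -1)) = 0.
  move=> t te t0; set y := c + t^-1.
  have ct0 : 0 < cmod t.
    by rewrite lt_neqAle cmod_ge0 andbT eq_sym; apply: contra t0 => /eqP/Normc.eq0_normc ->.
  have yc : y - c = t^-1 by rewrite /y addrC addKr.
  have tb : K + cmod c + r + 1 < cmod (y - c).
    by rewrite yc Normc.normcV -[ltLHS]invrK ltf_pV2 ?posrE ?invr_gt0.
  have cc := cmod_ge0 c; have K0' := K0.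
  have ry : r < cmod (y - c) by lra.
  have Ky : K < cmod y.
    have : cmod (y - c) <= cmod y + cmod c by rewrite -(normcN c); exact: le_normcD.
    by lra.
  have yt : y * t = 1 + c * t by rewrite /y mulrDl mulVf // addrC.
  have := cauchy_eq_exterior Ky.
  have -> : y * C y = (1 + c * t) * U t.
    by rewrite (cauchy_kernel mS muS r0 ry Sr) yc invrK mulrA yt.
  by move=> ->; rewrite -yt; ring.
have := pseries_id0 r0 rho0 rhor HH (pseries_coef0 rho0 e0 HH H0) (t := (z - c)^-1).
rewrite Normc.normcV lexx => /(_ isT).
have zt : z * (z - c)^-1 = 1 + c * (z - c)^-1 by field.
have -> : (1 + c * (z - c)^-1) * U (z - c)^-1 = z * C z.
  by rewrite (cauchy_kernel mS muS r0 rz Sr) mulrA zt.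
rewrite -zt => /eqP; rewrite mulN1r subr_eq0 -mulrA mulrCA => /eqP E.
by apply: (mulfI (x := (z - c)^-1)); rewrite ?invr_eq0.
Qed.

End AlgebraicContinuation.

(** * Complex differentiability of the Cauchy transform *)

Section CauchyDerivative.
Variables (R : realType) (mu : probability (plane R) R) (S : set (plane R)).
Hypotheses (mS : measurable S) (muS : mu (~` S) = 0%E).

Lemma cmeasurable_cauchy (z : R[i]) : cmeasurable (fun p : plane R => (z - toC p)^-1).
Proof.
apply: cmeasurableV; apply: cmeasurableB; first exact: cmeasurable_cst.
exact: cmeasurable_toC.
Qed.

Lemma cauchy_bounded (z : R[i]) d : 0 < d ->
  (forall p, S p -> d <= cmod (z - toC p)) ->
  cbounded S (fun p => (z - toC p)^-1) d^-1.
Proof.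
move=> d0 Sd; split=> [|p Sp]; first exact: cmeasurable_cauchy.
by rewrite Normc.normcV lef_pV2 ?posrE ?Sd // (lt_le_trans d0) // Sd.
Qed.

(** With [a = z - p], integrate [1 / (a + h) = 1 / a - h / a ^ 2 + h ^ 2 / (a ^ 2 (a + h))]; the
    last term is [O(h ^ 2)] uniformly on [S]. *)
Lemma cauchy_derivable (z : R[i]) d : 0 < d ->
  (forall p, S p -> d <= cmod (z - toC p)) ->
  derivable (cauchy_transform mu : R[i]^o -> R[i]^o) z 1.
Proof.
move=> d0 Sd; set k2 := fun p => (z - toC p)^-1 * (z - toC p)^-1.
have bz := cauchy_bounded d0 Sd.
have m2 : cmeasurable k2 by apply: cmeasurableM; exact: cmeasurable_cauchy.
have b2 : cbounded S k2 (d^-1 * d^-1).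
  split=> // p Sp; have [_ B] := bz.
  by rewrite Normc.normcM ler_pM ?cmod_ge0 // B.
apply/cvg_ex; exists (- cint mu k2 : R[i]^o).
apply/cvgrPdist_le => e e0.
have [e1 e10 ee] : exists2 e1 : R, 0 < e1 & e = e1%:C.
  exists (complex.Re e); first by move: e0; rewrite ltcE /= => /andP[].
  by move: e0; rewrite ltcE /= => /andP[/eqP E _]; case: (e) E => a b /= ->.
(* The first bound keeps [z + h] at distance [d / 2] from [S]; the second makes the error in the
   difference quotient, at most [4 cmod h / d ^ 3], smaller than [e]. *)
pose del := Num.min (d / 2) (e1 * d ^+ 3 / 4).
have del0 : 0 < del by rewrite lt_min !(divr_gt0, mulr_gt0, exprn_gt0).
exists del%:C; first by rewrite /= ltcR.
move=> h /=; rewrite sub0r normrN => hdel hn0.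
have {}hdel : cmod h < del by move: hdel; rewrite -ltcR.
have [hd he] : cmod h < d / 2 /\ cmod h < e1 * d ^+ 3 / 4.
  by move: hdel; rewrite lt_min => /andP[].
have Sdh p : S p -> d / 2 <= cmod (h + z - toC p).
  move=> Sp; have := Sd p Sp; have := cmodB_ge (z - toC p) (- h).
  by rewrite normcN opprK (_ : z - toC p + h = h + z - toC p); [lra|ring].
have d20 : 0 < d / 2 by rewrite divr_gt0.
have bh := cauchy_bounded d20 Sdh.
set q := fun p => k2 p * (h + z - toC p)^-1.
have mq : cmeasurable q by apply: cmeasurableM => //; exact: cmeasurable_cauchy.
have bq : cbounded S q (d^-1 * d^-1 * (d / 2)^-1).
  split=> // p Sp; have [_ B2] := b2; have [_ Bh] := bh.
  by rewrite Normc.normcM ler_pM ?cmod_ge0 // ?B2 // Bh.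
have bhk := cboundedZ (- h) b2; have bhq := cboundedZ (h * h) bq.
have -> : cauchy_transform mu (h *: (1 : R[i]^o) + z) =
    cauchy_transform mu z + (- h * cint mu k2 + h * h * cint mu q).
  rewrite (_ : h *: (1 : R[i]^o) + z = h + z); last by congr (_ + _); exact: mulr1.
  rewrite !cauchy_cint -(cintZ mS muS _ b2) -(cintZ mS muS _ bq).
  rewrite -(cintD mS muS bhk bhq) -(cintD mS muS bz (cboundedD bhk bhq)).
  apply: (cint_eq mS muS bh).
    by have [] := cboundedD bz (cboundedD bhk bhq).
  move=> p Sp; rewrite /q /k2.
  have zp : z - toC p != 0.
    by apply/eqP => E; have := Sd p Sp; rewrite E cmod0 => /(lt_le_trans d0); rewrite ltxx.
  have hzp : h + z - toC p != 0.
    by apply/eqP => E; have := Sdh p Sp; rewrite E cmod0 => /(lt_le_trans d20); rewrite ltxx.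
  by move: (toC p) zp hzp => x zp hzp; field; rewrite zp hzp.
rewrite [X in `|X|](_ : _ = - (h * cint mu q)); last first.
  rewrite [_ + _ - cauchy_transform mu z]addrC addKr; change (- cint mu k2 - h^-1 * (- h * cint mu k2 + h * h * cint mu q) = - (h * cint mu q)).
  by field.
rewrite ee normrN; change ((cmod (h * cint mu q))%:C <= e1%:C).
rewrite lecR Normc.normcM; have Bq := cint_bound mS muS bq.
apply: (le_trans (ler_wpM2l (cmod_ge0 _) Bq)).
have -> : 2 * (d^-1 * d^-1 * (d / 2)^-1) = 4 / d ^+ 3 by field; rewrite gt_eqF.
rewrite mulrA ler_pdivrMr ?exprn_gt0 //.
by move: he; rewrite ltr_pdivlMr // => /ltW.
Qed.

End CauchyDerivative.

(** * Moments of the angular variable *)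

Section Chebyshev.
Variable R : realType.
Implicit Types (c x y : R).

(** Chebyshev polynomials of the second kind, shifted by one: [cheb n (cos x)] is
    [sin (n x) / sin x], with the singularity at [x = 0] removed. *)
Fixpoint cheb (n : nat) c : R :=
  if n is n'.+1 then if n' is n''.+1 then 2 * c * cheb n' c - cheb n'' c else 1
  else 0.

Lemma chebSS n c : cheb n.+2 c = 2 * c * cheb n.+1 c - cheb n c.
Proof. by []. Qed.

Lemma sin_cos_cheb n x :
  sin (n.+1%:R * x) = sin x * cheb n.+1 (cos x) /\
  cos (n.+1%:R * x) = cos x * cheb n.+1 (cos x) - cheb n (cos x).
Proof.
elim: n => [|n [IHs IHc]]; first by rewrite mul1r /= !mulr1 subr0.
rewrite chebSS -natr1 mulrDl mul1r sinD cosD IHs IHc; split; first by ring.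
by have s2 := sin2cos2 x; ring: (sin2cos2 x).
Qed.

Lemma sin_cheb n x : sin (n%:R * x) = sin x * cheb n (cos x).
Proof.
by case: n => [|n]; [rewrite mul0r sin0 mulr0 | case: (sin_cos_cheb n x)].
Qed.

Lemma cheb1 n : cheb n 1 = n%:R.
Proof.
suff [] : cheb n 1 = n%:R /\ cheb n.+1 1 = n.+1%:R by [].
elim: n => [|n [IH1 IH2]] //; split=> //.
by rewrite chebSS IH1 IH2 -!natr1; ring.
Qed.

Lemma derivable_cheb n x : derivable (fun y => cheb n (cos y)) x 1.
Proof.
suff [] : derivable (fun y => cheb n (cos y)) x 1 /\
    derivable (fun y => cheb n.+1 (cos y)) x 1 by [].
elim: n => [|n [IH1 IH2]]; first by split; exact: derivable_cst.
split=> //; rewrite (_ : (fun y => cheb n.+2 (cos y)) =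
   ((fun=> 2) * (@cos R)) * (fun y => cheb n.+1 (cos y)) - (fun y => cheb n (cos y))) //.
by apply: derivableB => //; apply: derivableM => //; apply: derivableM.
Qed.

Lemma continuous_cheb n : continuous (fun y : R => cheb n (cos y)).
Proof.
by move=> x; apply/differentiable_continuous/derivable1_diffP/derivable_cheb.
Qed.

Variable m : nat.
Hypothesis m2 : (2 <= m)%N.

Let mgt0 : 0 < m%:R :> R. Proof. by rewrite ltr0n; lia. Qed.

Lemma cheb_gt0 n x : (0 < n < m)%N -> 0 <= x <= pi / m%:R -> 0 < cheb n (cos x).
Proof.
move=> /andP[n0 nm] /andP[]; rewrite le_eqVlt => /predU1P[<- _|x0 xm].
  by rewrite cos0 cheb1 ltr0n.
have xm' : x * m%:R <= pi by rewrite -ler_pdivlMr.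
have nm' : n%:R + 1 <= m%:R :> R by rewrite natr1 ler_nat.
have n1 : 1 <= n%:R :> R by rewrite ler1n.
have s1 : 0 < sin x.
  by apply: sin_gt0_pi; apply/andP; split => //; nra.
have s2 : 0 < sin (n%:R * x).
  by apply: sin_gt0_pi; apply/andP; split; [rewrite mulr_gt0 // ltr0n | nra].
by move: s2; rewrite sin_cheb pmulr_rgt0.
Qed.

Lemma cheb_ge0 n x : (n <= m)%N -> 0 <= x <= pi / m%:R -> 0 <= cheb n (cos x).
Proof.
move=> nm; have [n0|n0] := posnP n; first by rewrite n0.
move=> /andP[]; rewrite le_eqVlt => /predU1P[<- _|x0 xm].
  by rewrite cos0 cheb1.
have xm' : x * m%:R <= pi by rewrite -ler_pdivlMr.
have nm' : n%:R <= m%:R :> R by rewrite ler_nat.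
have m2' : 2 <= m%:R :> R by rewrite ler_nat.
have p0 := pi_gt0 R.
have s1 : 0 < sin x.
  by apply: sin_gt0_pi; apply/andP; split => //; nra.
have s2 : 0 <= sin (n%:R * x).
  by apply: sin_ge0_pi; apply/andP; split; [rewrite mulr_ge0 // ltW | nra].
by move: s2; rewrite sin_cheb pmulr_rge0.
Qed.

(** For [n > 0] this says that [cheb n / n] does not increase with [n]; it follows from the
    recurrence, [cos x <= 1] and positivity. Here it serves to bound [fc_angle] by its value at
    0. *)
Lemma cheb_ratio n x : (n < m)%N -> 0 <= x <= pi / m%:R ->
  n%:R * cheb n.+1 (cos x) <= n.+1%:R * cheb n (cos x).
Proof.
move=> nm xm; elim: n nm => [|n IH] nm; first by rewrite mul0r mulr0.
have {}IH := IH (ltnW nm).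
have p1 := cheb_ge0 (ltnW nm) xm.
rewrite chebSS.
have c1 : cos x <= 1 := cos_le1 x.
rewrite -(@natr1 _ n.+1); move: IH p1; rewrite -(@natr1 _ n).
move: (cheb n.+1 _) (cheb n _) => A B.
have n0 : 0 <= n%:R :> R by [].
move: (n%:R) n0 (cos x) c1 => k k0 c c1 H A0.
have : 0 <= (1 - c) * A * (k + 1) by rewrite !mulr_ge0 ?subr_ge0 ?addr_ge0.
by nra.
Qed.

Lemma cheb_le n x : (n <= m)%N -> 0 <= x <= pi / m%:R -> cheb n (cos x) <= n%:R.
Proof.
move=> nm xm; elim: n nm => [|[|n] IH] nm //.
have H := cheb_ratio nm xm; have {}IH := IH (ltnW nm).
rewrite -(ler_pM2l (_ : 0 < n.+1%:R)) ?ltr0n //; apply: (le_trans H).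
by rewrite mulrC ler_wpM2r.
Qed.

End Chebyshev.

Section Moivre.
Variable R : realType.

Definition cis (x : R) : R[i] := cos x +i* sin x.

Lemma cisD x y : cis (x + y) = cis x * cis y.
Proof.
rewrite /cis cosD sinD; apply/eqP; rewrite eq_complex /= eqxx /=.
by rewrite addrC.
Qed.

Lemma cis0 : cis 0 = 1.
Proof. by rewrite /cis cos0 sin0. Qed.

Lemma cisX n x : cis x ^+ n = cis (n%:R * x).
Proof.
elim: n => [|n IH]; first by rewrite mul0r cis0.
by rewrite exprS IH -cisD -natr1 mulrDl mul1r addrC.
Qed.

Lemma cis_neq0 x : cis x != 0.
Proof.
have : cis x * cis (- x) = 1 by rewrite -cisD subrr cis0.
by apply: contra_eqN => /eqP ->; rewrite mul0r eq_sym oner_eq0.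
Qed.

Lemma cisN x : cis (- x) = (cis x)^-1.
Proof.
by apply: (mulfI (cis_neq0 x)); rewrite -cisD subrr cis0 divff ?cis_neq0.
Qed.

Lemma Re_realM (a : R) (z : R[i]) : complex.Re (a%:C * z) = a * complex.Re z.
Proof. by case: z => x y /=; rewrite mul0r subr0. Qed.

Lemma Im_realM (a : R) (z : R[i]) : complex.Im (a%:C * z) = a * complex.Im z.
Proof. by case: z => x y /=; rewrite mul0r addr0. Qed.

End Moivre.

(** * The curve on which [(1 + v) ^ m / v] is real *)

Section FussCatalanAngle.
Variable (R : realType) (m : nat).
Hypothesis m2 : (2 <= m)%N.

Let mgt0 : 0 < m%:R :> R. Proof. by rewrite ltr0n; lia. Qed.

Local Notation g := (fun x : R => cheb m.-1 (cos x)).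

(** For [0 < x < pi / m] this is [sin (m x) ^ m / (sin x sin ((m - 1) x) ^ (m - 1))], the value of
    [(1 + v) ^ m / v] on the curve. *)
Definition fc_angle (x : R) : R := cheb m (cos x) ^+ m / g x ^+ m.-1.

Let v (x : R) : R[i] := ((g x)^-1)%:C * cis (m%:R * x).

Lemma v_neq0 x : g x != 0 -> v x != 0.
Proof.
move=> g0; rewrite mulf_neq0 ?cis_neq0 //.
by rewrite -(rmorph0 (real_complex R)) (inj_eq (@complexI R)) invr_eq0.
Qed.

(** From [sin ((m - 1) x) + e ^ (i m x) sin x = e ^ (i x) sin (m x)], the number [1 + v] is real up
    to the factor [e ^ (i x)], whose power [m] is the phase of [v]. *)
Lemma expr_1Dv x : g x != 0 -> (1 + v x) ^+ m = (fc_angle x)%:C * v x.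
Proof.
move=> g0; have m1 : m.-1.+1 = m by lia.
have [Hs Hc] := sin_cos_cheb m.-1 x; rewrite m1 in Hs Hc.
have -> : 1 + v x = (cheb m (cos x) / g x)%:C * cis x.
  rewrite /v /cis Hs Hc; apply/eqP; rewrite eq_complex; apply/andP; split; apply/eqP => /=;
  by rewrite ?mul0r ?subr0 ?addr0; field.
rewrite exprMn cisX -rmorphXn /v mulrA -rmorphM; congr (_%:C * _).
by rewrite /fc_angle expr_div_n -{4}m1 exprS invfM mulrCA mulrC.
Qed.

Lemma fc_angle_binomial k x : g x != 0 ->
  \sum_(j < (m * k).+1) ('C(m * k, j)%:R * (v x ^+ j / v x ^+ k)) = (fc_angle x ^+ k)%:C.
Proof.
move=> g0; have v0 := v_neq0 g0.
have := congr1 (fun z => z ^+ k / v x ^+ k) (expr_1Dv g0).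
rewrite /= [(_%:C * v x) ^+ k]exprMn mulfK ?expf_neq0 // -exprM rmorphXn => <-.
rewrite exprDn mulr_suml; apply: eq_bigr => j _.
by rewrite expr1n mul1r mulrA mulr_natl.
Qed.

(** The imaginary part of a primitive of [v ^ (j - k)] with respect to [log v]:
    [v ^ (j - k) / (j - k)] in general, and [log v], of imaginary part [m x], for [j = k]. Cases
    keep the exponents natural. *)
Definition fc_term k j (x : R) : R :=
  if (j < k)%N then g x ^+ (k - j) * sin ((k - j)%:R * (m%:R * x)) / (k - j)%:R
  else if j == k then m%:R * x
  else (g x)^-1 ^+ (j - k) * sin ((j - k)%:R * (m%:R * x)) / (j - k)%:R.

Lemma is_derive_mull (c x : R) : is_derive x 1 (fun y : R => c * y) c.
Proof.
rewrite (_ : (fun y : R => c * y) = c \*: (@id R)) //.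
by apply: is_derive_eq; exact: mulr1.
Qed.

Lemma is_derive_power_sin (rho : R -> R) (drho x : R) n : (0 < n)%N ->
  rho x != 0 -> is_derive x 1 rho drho ->
  is_derive x 1 (fun y => rho y ^+ n * sin (n%:R * (m%:R * y)) / n%:R)
    (rho x ^+ n * (drho / rho x * sin (n%:R * (m%:R * x)) +
                   m%:R * cos (n%:R * (m%:R * x)))).
Proof.
move=> n0 r0 dr.
have D : is_derive x 1 (fun y : R => sin (n%:R * (m%:R * y)))
    (cos (n%:R * (m%:R * x)) * (n%:R * m%:R)).
  have -> : (fun y : R => sin (n%:R * (m%:R * y))) = sin \o (fun y => (n%:R * m%:R) * y).
    by apply/funext => y; rewrite /= mulrA.
  rewrite (mulrA n%:R m%:R x); apply: is_derive1_comp; exact: is_derive_mull.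
have DX := is_deriveX n dr.
have DM := is_deriveM DX D.
have := is_deriveZ n%:R^-1 DM.
have nn0 : n%:R != 0 :> R by rewrite pnatr_eq0 -lt0n.
have -> : n%:R^-1 \*: (rho ^+ n * (fun y : R => sin (n%:R * (m%:R * y)))) =
  (fun y => rho y ^+ n * sin (n%:R * (m%:R * y)) / n%:R).
  by apply/funext => y; rewrite /= exprfctE mulrfctE [LHS]mulrC.
move=> H; apply: (is_derive_eq H); rewrite /GRing.scale /= exprfctE.
have -> : rho x ^+ n = rho x * rho x ^+ n.-1 by rewrite -exprS prednK.
by field; rewrite nn0 r0.
Qed.

Lemma is_derive_fc_term k j x dg : g x != 0 -> is_derive x 1 g dg ->
  is_derive x 1 (fc_term k j)
    (- (dg / g x) * complex.Im (v x ^+ j / v x ^+ k) + m%:R * complex.Re (v x ^+ j / v x ^+ k)).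
Proof.
move=> g0 Dg; have vE n : v x ^+ n = ((g x)^-1 ^+ n)%:C * cis (n%:R * (m%:R * x)).
  by rewrite exprMn cisX rmorphXn.
have v0 := v_neq0 g0.
have [jk|kj|->] := ltngtP j k.
- have -> : v x ^+ j / v x ^+ k = (g x ^+ (k - j))%:C * cis (- ((k - j)%:R * (m%:R * x))).
    rewrite -[LHS]invf_div -expfB // vE [LHS]invfM -cisN -fmorphV exprVn invrK //.
  rewrite Re_realM Im_realM /= cosN sinN /fc_term jk.
  have n0 : (0 < k - j)%N by rewrite subn_gt0.
  by apply: (is_derive_eq (is_derive_power_sin n0 g0 Dg)); ring.
- have -> : v x ^+ j / v x ^+ k = ((g x)^-1 ^+ (j - k))%:C * cis ((j - k)%:R * (m%:R * x)).
    by rewrite -expfB // vE.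
  rewrite Re_realM Im_realM /= /fc_term ltnNge (ltnW kj) /= gtn_eqF //.
  have DV := is_deriveV g0 Dg; have gV0 : (g x)^-1 != 0 by rewrite invr_eq0.
  have n0 : (0 < j - k)%N by rewrite subn_gt0.
  have H := is_derive_power_sin (rho := fun y => (g y)^-1) n0 gV0 DV.
  by apply: (is_derive_eq H); rewrite /GRing.scale /=; field.
- rewrite divff ?expf_neq0 //= mulr0 add0r mulr1.
  rewrite /fc_term ltnn eqxx.
  exact: is_derive_mull.
Qed.

Definition fc_primitive k (x : R) : R :=
  m%:R^-1 * \sum_(j < (m * k).+1) ('C(m * k, j)%:R * fc_term k j x).

Lemma is_derive_fc_primitive k x : g x != 0 ->
  is_derive x 1 (fc_primitive k) (fc_angle x ^+ k).
Proof.
move=> g0; pose dg := 'D_1 g x.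
have Dg : is_derive x 1 g dg by apply/derivableP; exact: derivable_cheb.
pose d j := - (dg / g x) * complex.Im (v x ^+ j / v x ^+ k) +
            m%:R * complex.Re (v x ^+ j / v x ^+ k).
have H (j : 'I_(m * k).+1) : is_derive x 1 ('C(m * k, j)%:R \*: fc_term k j)
    ('C(m * k, j)%:R *: d j).
  exact/is_deriveZ/is_derive_fc_term.
have := is_deriveZ m%:R^-1 (is_derive_sum H).
rewrite (_ : _ \*: _ = fc_primitive k); last first.
  by apply/funext => y; rewrite fct_sumE.
move=> D; apply: (is_derive_eq D).
have E := fc_angle_binomial k g0.
(* The binomial sum is real, so its imaginary part kills the term in [dg / g] and its real part is
   the power of [fc_angle]. *)
have EI := congr1 (fun z => complex.Im z) E; have ER := congr1 (fun z => complex.Re z) E.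
rewrite /= !raddf_sum /= in EI ER.
rewrite /GRing.scale /= -ER.
have -> : \sum_(j < (m * k).+1) 'C(m * k, j)%:R * d j =
   - (dg / g x) * (\sum_(j < (m * k).+1) complex.Im ('C(m * k, j)%:R * (v x ^+ j / v x ^+ k))) +
   m%:R * (\sum_(j < (m * k).+1) complex.Re ('C(m * k, j)%:R * (v x ^+ j / v x ^+ k))).
  rewrite !mulr_sumr -big_split /=; apply: eq_bigr => j _.
  rewrite -(rmorph_nat (real_complex R)) Re_realM Im_realM /d; ring.
by rewrite EI mulr0 add0r mulKf // gt_eqF.
Qed.

Let g_neq0 x : 0 <= x <= pi / m%:R -> g x != 0.
Proof. by move=> xm; rewrite gt_eqF // (@cheb_gt0 _ m) //; lia. Qed.

(** All the sines vanish at both ends, so only the term [j = k] contributes. *)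
Lemma fc_primitive_ends k :
  fc_primitive k (pi / m%:R) - fc_primitive k 0 = pi / m%:R * 'C(m * k, k)%:R.
Proof.
rewrite /fc_primitive -mulrBr -sumrB.
have kmk : (k < (m * k).+1)%N by rewrite ltnS leq_pmull //; lia.
rewrite (bigD1 (Ordinal kmk)) //= big1 => [|j /negPf jk].
  rewrite /fc_term ltnn eqxx mulr0 mulr0 subr0 addr0; field.
  by rewrite gt_eqF.
have sinpi n : sin (n%:R * (m%:R * (pi / m%:R))) = 0 :> R.
  rewrite (_ : m%:R * (pi / m%:R) = pi); last by field; rewrite gt_eqF.
  elim: n => [|n IH]; first by rewrite mul0r sin0.
  by rewrite -natr1 mulrDl mul1r sinDpi IH oppr0.
rewrite -val_eqE /= in jk.
by rewrite /fc_term jk; case: ifP => _; rewrite sinpi !mulr0 sin0 !mulr0 !mul0r mulr0 subr0.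
Qed.

Lemma continuous_expr (T : topologicalType) (f : T -> R) n x :
  {for x, continuous f} -> {for x, continuous (fun y => f y ^+ n)}.
Proof.
by move=> cf; apply: (@continuous_comp _ _ _ f (fun y => y ^+ n)) => //; exact: exprn_continuous.
Qed.

Lemma continuous_fc_angle x : g x != 0 -> {for x, continuous fc_angle}.
Proof.
move=> g0; apply: continuousM; first exact/continuous_expr/continuous_cheb.
by apply: continuousV; [rewrite expf_neq0|apply/continuous_expr/continuous_cheb].
Qed.

Lemma integral_fc_angle k :
  (\int[lebesgue_measure]_(x in `[0%R, (pi / m%:R)%R]) (fc_angle x ^+ k)%:E =
   (pi / m%:R * 'C(m * k, k)%:R)%:E)%E.
Proof.
have b0 : 0 < pi / m%:R :> R by rewrite divr_gt0 // pi_gt0.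
have der x : 0 <= x <= pi / m%:R -> is_derive x 1 (fc_primitive k) (fc_angle x ^+ k).
  by move=> xm; apply/is_derive_fc_primitive/g_neq0.
have cont x : 0 <= x <= pi / m%:R -> {for x, continuous (fc_primitive k)}.
  by move=> xm; apply/differentiable_continuous/derivable1_diffP/(@ex_derive _ _ _ _ _ _ _ (der x xm)).
rewrite (@continuous_FTC2 _ _ (fc_primitive k)) //.
- by rewrite -EFinB fc_primitive_ends.
- apply: continuous_in_subspaceT => x; rewrite inE /= in_itv /= => xm.
  exact/continuous_expr/continuous_fc_angle/g_neq0.
- split.
  + move=> x; rewrite in_itv /= => /andP[x0 xm].
    by apply: (@ex_derive _ _ _ _ _ _ _ (der x _)); rewrite !ltW.
  + by apply: cvg_at_right_filter; apply: cont; rewrite lexx ltW.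
  + by apply: cvg_at_left_filter; apply: cont; rewrite lexx ltW.
- move=> x; rewrite in_itv /= => /andP[x0 xm].
  have xi : 0 <= x <= pi / m%:R by rewrite !ltW.
  by rewrite derive1E (@derive_val _ _ _ _ _ _ _ (der x xi)).
Qed.

Lemma fc_angle0 : fc_angle 0 = fc_bound R m.
Proof. by rewrite /fc_angle cos0 !cheb1 /fc_bound subn1. Qed.

(** Write [fc_angle] as [cheb m] times the power [m - 1] of [cheb m / cheb (m - 1)]; these are at
    most [m] and [m / (m - 1)]. *)
Lemma fc_angle_bounds x : 0 <= x <= pi / m%:R -> 0 <= fc_angle x <= fc_bound R m.
Proof.
move=> xm; have A := @cheb_ge0 _ m m2 m x (leqnn _) xm.
have B : 0 < g x by apply: (@cheb_gt0 _ m) => //; lia.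
rewrite divr_ge0 ?exprn_ge0 ?(ltW B) //=.
have m1 : m.-1.+1 = m by lia.
have mm : (m.-1 < m)%N by lia.
have H := @cheb_ratio _ m m2 m.-1 x mm xm; rewrite m1 in H.
have p0 : 0 < m.-1%:R :> R by rewrite ltr0n; lia.
have C := @cheb_le _ m m2 m x (leqnn _) xm.
rewrite /fc_angle /fc_bound subn1 -{2 6}m1 !exprS -!mulrA -!expr_div_n.
apply: ler_pM => //; first by rewrite exprn_ge0 // divr_ge0 // ltW.
rewrite lerXn2r ?nnegrE ?divr_ge0 ?(ltW B) //.
by rewrite ler_pdivrMr // mulrAC ler_pdivlMr // mulrC.
Qed.

End FussCatalanAngle.

(** * The Fuss-Catalan measure *)

(* The uniform law as a measure for the Borel sigma-algebra carried by [R]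
   itself, that of [R * R] in the definitions; the library puts it on an alias
   of [R] with another display. *)
Section UniformLaw.
Variables (R : realType) (a b : R) (ab : a < b).

Definition uniform_law : set R -> \bar R := uniform_prob ab.

Let uniform_law0 : uniform_law set0 = 0%E.
Proof. exact: (measure0 (uniform_prob ab)). Qed.

Let uniform_law_ge0 A : (0 <= uniform_law A)%E.
Proof. exact: (measure_ge0 (uniform_prob ab)). Qed.

Let uniform_law_sigma_additive : semi_sigma_additive uniform_law.
Proof. exact: (@measure_semi_sigma_additive _ _ _ (uniform_prob ab)). Qed.

HB.instance Definition _ := isMeasure.Build _ _ _ uniform_law
  uniform_law0 uniform_law_ge0 uniform_law_sigma_additive.

Let uniform_law_setT : uniform_law [set: R] = 1%E.
Proof. exact: (@probability_setT _ _ _ (uniform_prob ab)). Qed.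

HB.instance Definition _ := Measure_isProbability.Build _ _ _ uniform_law uniform_law_setT.

Lemma integral_uniform_law (f : R -> \bar R) :
  measurable_fun setT f -> (forall x, 0 <= f x)%E ->
  (\int[uniform_law]_x f x =
   (b - a)^-1%:E * \int[@lebesgue_measure R]_(x in `[a, b]) f x)%E.
Proof.
move=> mf f0; rewrite -integral_uniform //.
have mid : measurable_fun setT (id : R -> measurableTypeR R) by [].
exact/esym/(@ge0_integral_pushforward _ _ _ _ _ _ mid uniform_law setT f).
Qed.

End UniformLaw.

Lemma is_derive_exprS_div (R : realType) n (x : R) :
  is_derive x 1 (fun y : R => y ^+ n.+1 / n.+1%:R) (x ^+ n).
Proof.
have := is_deriveZ n.+1%:R^-1 (is_deriveX n.+1 (is_derive_id x (1 : R))).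
rewrite (_ : _ \*: _ = fun y : R => y ^+ n.+1 / n.+1%:R); last first.
  by apply/funext => y; rewrite /= exprfctE [LHS]mulrC.
move=> H; apply: (is_derive_eq H); rewrite /GRing.scale /= mulr1.
by rewrite mulrA mulVf ?mul1r // pnatr_eq0.
Qed.

Lemma integral_power01 (R : realType) n :
  (\int[@lebesgue_measure R]_(x in `[0%R, 1%R]) (x ^+ n)%:E = (n.+1%:R^-1)%:E)%E.
Proof.
have cont x : {for x, continuous (fun y : R => y ^+ n.+1 / n.+1%:R)}.
  apply/differentiable_continuous/derivable1_diffP.
  exact: (@ex_derive _ _ _ _ _ _ _ (is_derive_exprS_div n x)).
rewrite (@continuous_FTC2 _ _ (fun y => y ^+ n.+1 / n.+1%:R)) //.
- by rewrite -EFinB expr1n expr0n /= mul0r subr0 mul1r.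
- by apply: continuous_subspaceT => x; exact: exprn_continuous.
- split.
  + by move=> x _; exact: (@ex_derive _ _ _ _ _ _ _ (is_derive_exprS_div n x)).
  + by apply: cvg_at_right_filter; exact: cont.
  + by apply: cvg_at_left_filter; exact: cont.
- move=> x _.
  by rewrite derive1E (@derive_val _ _ _ _ _ _ _ (is_derive_exprS_div n x)).
Qed.

Lemma uniform_prob_itv_gt0 (R : realType) (a b c d : R) (ab : a < b) :
  a <= c -> c < d -> d <= b -> (0 < uniform_prob ab `[c, d])%E.
Proof.
move=> ac cd db; rewrite /uniform_prob.
rewrite (eq_integral (fun=> (b - a)^-1%:E)); last first.
  move=> x; rewrite inE /= in_itv /= => /andP[cx xd].
  by rewrite /uniform_pdf (le_trans ac cx) (le_trans xd db).
rewrite integral_cst //= lebesgue_measure_itv /= lte_fin cd -EFinB -EFinM lte_fin.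
by rewrite mulr_gt0 ?invr_gt0 ?subr_gt0.
Qed.

Lemma uniform_prob_itv (R : realType) (a b : R) (ab : a < b) :
  uniform_prob ab `[a, b] = 1%E.
Proof. exact: integral_uniform_pdf1. Qed.

Section FussCatalanMeasure.
Variable (R : realType) (m : nat).
Hypothesis m2 : (2 <= m)%N.

Let mgt0 : 0 < m%:R :> R. Proof. by rewrite ltr0n; lia. Qed.

Let b0 : (0 : R) < pi / m%:R. Proof. by rewrite divr_gt0 // pi_gt0. Qed.

Let K0 : 0 < fc_bound R m.
Proof. by rewrite divr_gt0 ?exprn_gt0 // ltr0n; lia. Qed.

(** The first coordinate is the angle, the second the variable [s]. The absolute values change
    nothing on the box that carries the law, and make the image nonnegative everywhere, as Tonelli's
    theorem requires. *)
Definition fc_map (p : plane R) : plane R :=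
  (`|fc_angle m p.1| * `|p.2| ^+ (m - 1), 0).

Lemma measurable_fc_angle : measurable_fun setT (@fc_angle R m).
Proof.
have mc n : measurable_fun setT (fun x : R => cheb n (cos x)).
  by apply: continuous_measurable_fun; exact: continuous_cheb.
have mX (f : R -> R) n : measurable_fun setT f -> measurable_fun setT (fun x => f x ^+ n).
  by move=> mf; exact: measurable_funX.
apply: measurable_funM; first by apply: mX; exact: mc.
by apply: (measurable_funVr (f := fun x => cheb m.-1 (cos x) ^+ m.-1)); apply: mX; exact: mc.
Qed.

Lemma measurable_fc_map : measurable_fun setT fc_map.
Proof.
have mn (f : plane R -> R) : measurable_fun setT f -> measurable_fun setT (fun p => `|f p|).
  by move=> mf; exact: measurableT_comp.
apply: measurable_fun_pair; last exact: measurable_cst.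
apply: measurable_funM.
  by apply: mn; apply: (measurableT_comp measurable_fc_angle); exact: measurable_fst.
by apply: measurable_funX; apply: mn; exact: measurable_snd.
Qed.

HB.instance Definition _ := isMeasurableFun.Build _ _ _ _ _ measurable_fc_map.

Let P1 : probability R R :=
  [the probability _ R of uniform_law b0].
Let P2 : probability R R :=
  [the probability _ R of uniform_law (@ltr01 R)].
Let P : probability (plane R) R := (P1 \x P2)%E.

Definition fc_measure : probability (plane R) R := distribution P fc_map.

Local Notation S := (fc_segment R m).

Lemma fc_segmentE : S = `[0, fc_bound R m]%classic `*` [set 0].
Proof. by apply/seteqP; split=> -[x y] /=; rewrite in_itv. Qed.

Lemma measurable_fc_segment : measurable S.
Proof. by rewrite fc_segmentE; exact: measurableX. Qed.

Lemma compact_fc_segment : compact S.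
Proof.
by rewrite fc_segmentE; apply: compact_setX; [exact: segment_compact|exact: compact_set1].
Qed.

Lemma fc_map_segment p : `[0, pi / m%:R]%classic p.1 -> `[0, 1]%classic p.2 -> S (fc_map p).
Proof.
rewrite /= !in_itv /= => p1 /andP[p20 p21]; split=> //=.
have /andP[A0 AK] := fc_angle_bounds m2 p1.
rewrite (ger0_norm A0) (ger0_norm p20) mulr_ge0 ?exprn_ge0 //=.
by rewrite -[leRHS]mulr1 ler_pM ?exprn_ge0 // exprn_ile1.
Qed.

Lemma fc_measure_supported : fc_measure (~` S) = 0%E.
Proof.
have mb : measurable (`[0, pi / m%:R]%classic : set R) by [].
have m1 : measurable (`[0, 1]%classic : set R) by [].
have box1 : P (`[0, pi / m%:R]%classic `*` `[0, 1]%classic) = 1%E.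
  transitivity (uniform_prob b0 `[0%R, (pi / m%:R)%R] * uniform_prob (@ltr01 R) `[0%R, 1%R])%E.
    exact: (product_measure1E P1 P2 mb m1).
  by rewrite !uniform_prob_itv mule1.
have box0 : P (~` (`[0, pi / m%:R]%classic `*` `[0, 1]%classic)) = 0%E.
  by rewrite probability_setC ?box1 ?subee //; exact: measurableX.
apply/eqP; rewrite eq_le measure_ge0 andbT -box0.
apply: (@le_measure _ _ _ P (fc_map @^-1` (~` S))); rewrite ?inE.
- rewrite -[X in measurable X]setTI; apply: measurable_fc_map => //.
  by apply: measurableC; exact: measurable_fc_segment.
- apply: measurableC; exact: measurableX.
- by move=> p /= nS [/= h1 h2]; apply: nS; exact: fc_map_segment.
Qed.

Lemma fc_measure_moment k :
  (\int[P]_p ((fc_map p).1 ^+ k)%:E = (raney m k 1)%:R%:E)%E.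
Proof.
have mX1 : measurable_fun setT (fun x : R => (`|fc_angle m x| ^+ k)%:E).
  apply/measurable_EFinP; apply: measurable_funX; apply: measurableT_comp => //.
  exact: measurable_fc_angle.
have mX2 : measurable_fun setT (fun y : R => (`|y| ^+ ((m - 1) * k))%:E).
  by apply/measurable_EFinP; apply: measurable_funX; exact: normr_measurable.
rewrite fubini_tonelli1; first last.
- by move=> p; rewrite lee_fin /= exprn_ge0 // mulr_ge0 ?exprn_ge0.
- apply/measurable_EFinP; apply: measurable_funX.
  by apply: (measurableT_comp _ measurable_fc_map); exact: measurable_fst.
rewrite /fubini_F /=.
have inner x : (\int[P2]_y ((`|fc_angle m x| * `|y| ^+ (m - 1)) ^+ k)%:E =
    (`|fc_angle m x| ^+ k)%:E * (((m - 1) * k).+1%:R^-1)%:E)%E.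
  under eq_integral do rewrite exprMn -exprM EFinM.
  rewrite ge0_integralZl //.
  congr (_ * _)%E; rewrite integral_uniform_law //.
  rewrite subr0 invr1 mul1e -integral_power01.
  by apply: eq_integral => y; rewrite inE /= in_itv /= => /andP[y0 _]; rewrite ger0_norm.
under eq_integral do rewrite inner.
rewrite ge0_integralZr //.
rewrite integral_uniform_law //.
have -> : (\int[@lebesgue_measure R]_(x in `[0%R, (pi / m%:R)%R]) (`|fc_angle m x| ^+ k)%:E =
   (pi / m%:R * 'C(m * k, k)%:R)%:E)%E.
  rewrite -[RHS](integral_fc_angle R m2 k); apply: eq_integral => x.
  rewrite inE /= in_itv /= => /(fc_angle_bounds m2) /andP[A0 _].
  by rewrite ger0_norm.
rewrite -!EFinM; congr (_%:E).
rewrite -(raney1 k (ltnW m2)) natrM subr0 addn1.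
have pm : pi / m%:R != 0 :> R by rewrite gt_eqF.
have n0 : ((m - 1) * k).+1%:R != 0 :> R by rewrite pnatr_eq0.
move: (pi / _) pm => q q0; move: (_.+1%:R) n0 => N N0. by field; rewrite q0 N0.
Qed.

Lemma fc_measure_cint k :
  cint fc_measure (fun p => toC p ^+ k) = (raney m k 1)%:R.
Proof.
have mS := measurable_fc_segment; have S0 := fc_measure_supported.
have bX : cbounded S (fun p => toC p ^+ k) (fc_bound R m ^+ k).
  split=> [|p Sp]; first exact/cmeasurableX/cmeasurable_toC.
  rewrite cmodX lerXn2r ?nnegrE ?cmod_ge0 ?(ltW K0) //.
  case: p Sp => x y [/= /andP[x0 xK] ->].
  by rewrite [toC _]/(x%:C) cmod_real ger0_norm.
have mp : measurable_fun setT (fun p : plane R => `|p.1| ^+ k).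
  by apply: measurable_funX; apply: measurableT_comp => //; exact: measurable_fst.
rewrite (cint_eq mS S0 bX (g := fun p => (`|p.1| ^+ k)%:C)); first last.
- case=> x y [/= /andP[x0 xK] ->].
  by rewrite /= ger0_norm // [RHS]rmorphXn.
- by split.
rewrite /cint /= /Rintegral.
have -> : (\int[fc_measure]_p (`|p.1| ^+ k)%:E = (raney m k 1)%:R%:E)%E.
  rewrite ge0_integral_distribution; last 2 first.
  - exact/measurable_EFinP.
  - by move=> p; rewrite lee_fin exprn_ge0.
  rewrite -fc_measure_moment; apply: eq_integral => p _ /=.
  by rewrite ger0_norm // mulr_ge0 // exprn_ge0.
by rewrite integral0 /= -[RHS](rmorph_nat (real_complex R)).
Qed.

Lemma continuous_fc_map0 s : {for (0, s), continuous fc_map}.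
Proof.
have cg : {for (0 : R), continuous (@fc_angle R m)}.
  by apply: continuous_fc_angle; rewrite // cos0 cheb1 pnatr_eq0; lia.
pose h (p : plane R) := `|fc_angle m p.1| * `|p.2| ^+ (m - 1).
have ch : {for (0, s), continuous h}.
  apply: continuousM.
    apply: (@continuous_comp _ _ _ (fun p : plane R => fc_angle m p.1) (fun x : R => `|x|)).
      by apply: (@continuous_comp _ _ _ fst (@fc_angle R m)) => //; exact: cvg_fst.
    exact: norm_continuous.
  apply: continuous_expr.
  apply: (@continuous_comp _ _ _ snd (fun x : R => `|x|)); first exact: cvg_snd.
  exact: norm_continuous.
exact: (cvg_pair ch (cvg_cst (0 : R))).
Qed.

(** Since [fc_angle 0] is the right end of the segment, the edge of angle 0 is mapped onto the whole
    segment. By continuity at a point of this edge, every neighbourhood of its image has a preimage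
    containing a rectangle of positive mass. *)
Lemma fc_measure_full_support : msupport fc_measure = S.
Proof.
have mS := measurable_fc_segment.
apply/seteqP; split=> [p Hp|[x y] [/= /andP[x0 xK] ->] U oU Ux].
  apply: contrapT => nSp.
  have oS : open (~` S).
    by rewrite openC; apply: compact_closed; [exact: norm_hausdorff|exact: compact_fc_segment].
  have := Hp _ oS nSp; rewrite [X in (_ < X)%E](_ : _ = 0%E) ?ltxx //.
  exact: fc_measure_supported.
(* Solves [fc_bound R m * s ^ (m - 1) = x]. *)
pose s := (x / fc_bound R m) `^ (m - 1)%:R^-1.
have xK01 : 0 <= x / fc_bound R m <= 1.
  by rewrite divr_ge0 ?(ltW K0) //= ler_pdivrMr // mul1r.
have m10 : (m - 1)%:R != 0 :> R by rewrite pnatr_eq0; lia.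
have s01 : 0 <= s <= 1.
  rewrite powR_ge0 /=; case/andP: xK01 => xK0 xK1.
  by rewrite -[leRHS](congr1 (fun f => f (m - 1)%:R^-1) (powR1 R)) ge0_ler_powR ?nnegrE ?invr_ge0.
have sm : s ^+ (m - 1) = x / fc_bound R m.
  case/andP: xK01 => xK0 _.
  by rewrite -powR_mulrn ?powR_ge0 // -powRrM mulVf // powRr1.
have Tp : fc_map (0, s) = (x, 0).
  rewrite /fc_map /= fc_angle0 // (gtr0_norm K0) ger0_norm; last by case/andP: s01.
  by rewrite sm mulrC divfK // gt_eqF.
have : nbhs (0, s) (fc_map @^-1` U).
  apply: continuous_fc_map0; rewrite Tp; exact: open_nbhs_nbhs.
case=> -[A B] [/= [e1 /= e10 A1] [e2 /= e20 B1]] AB.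
(* The rectangle is clipped to the box [[0, pi / m] x [0, 1]], where both laws have positive
   density. *)
pose d := Num.min (pi / m%:R) (e1 / 2).
pose c1 := Num.max 0 (s - e2 / 2); pose c2 := Num.min 1 (s + e2 / 2).
have mU := open_measurable_plane oU.
have mI1 : measurable (`[0, d]%classic : set R) by [].
have mI2 : measurable (`[c1, c2]%classic : set R) by [].
have d0 : 0 < d by rewrite lt_min b0 divr_gt0.
have c12 : c1 < c2.
  case/andP: s01 => s0 s1.
  by rewrite gt_max !lt_min ltr01 /=; apply/andP; split; [|apply/andP; split]; lra.
apply: (@lt_le_trans _ _ (P (`[0, d]%classic `*` `[c1, c2]%classic))).
  rewrite [ltRHS](product_measure1E P1 P2 mI1 mI2) mule_gt0 //.
    by apply: uniform_prob_itv_gt0 => //; rewrite ge_min lexx.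
  by apply: uniform_prob_itv_gt0; rewrite ?le_max ?ge_min ?lexx.
apply: (@le_measure _ _ _ P _ (fc_map @^-1` U)); rewrite ?inE.
- exact: measurableX.
- by rewrite -[X in measurable X]setTI; apply: measurable_fc_map.
move=> [p1 p2] [/=]; rewrite !in_itv /= => /andP[p10 p1d] /andP[p2c1 p2c2].
apply: AB; split=> /=.
  apply: A1; rewrite /= sub0r normrN ger0_norm // (le_lt_trans p1d) //.
  by rewrite gt_min; apply/orP; right; lra.
apply: B1; rewrite /= ltr_norml.
move: p2c1 p2c2; rewrite ge_max le_min => /andP[_ h1] /andP[_ h2].
by apply/andP; split; lra.
Qed.

End FussCatalanMeasure.

(** * Segments of the real axis *)

Lemma summable_single (R : realType) (T : choiceType) (k : T) (v : R) :
  summable [set: T] (fun i => (if i == k then v else 0)%:E).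
Proof.
rewrite /summable.
have -> : \esum_(i in [set: T]) `|(if i == k then v else 0)%:E|%E =
    \esum_(i in [set k]) `|v%:E|%E.
  rewrite [RHS]esum_mkcond; apply: eq_esum => i _.
  case: eqP => [->|ik]; first by rewrite mem_set.
  by rewrite memNset // abse0.
by rewrite esum_set1 ?abse_ge0 // abse_EFin ltry.
Qed.

Lemma affine_analytic_at (R : realType) (al be ga : R) (p : plane R) :
  analytic_at (fun q => al * q.1 + be * q.2 + ga) p.
Proof.
pose c (i j : nat) : R := (if (i, j) == (0, 0)%N then al * p.1 + be * p.2 + ga else 0) +
  ((if (i, j) == (1, 0)%N then al else 0) + (if (i, j) == (0, 1)%N then be else 0)).
exists c, 1; split=> // x y _ _ t; split.
  have -> : (fun ij : nat * nat => (t ij.1 ij.2)%:E) =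
    (fun ij => (if ij == (0, 0)%N then al * p.1 + be * p.2 + ga else 0)%:E) \+
    ((fun ij => (if ij == (1, 0)%N then al * (x - p.1) else 0)%:E) \+
     (fun ij => (if ij == (0, 1)%N then be * (y - p.2) else 0)%:E)).
    apply/funext => -[i j]; rewrite /= -!EFinD; congr (_%:E); rewrite /t /c /=.
    case: i j => [|[|i]] [|[|j]] //=; rewrite ?xpair_eqE /= ?expr0 ?expr1;
      by rewrite ?(add0r, addr0, mul0r, mulr1, mul1r).
  by apply: summableD; [|apply: summableD]; exact: summable_single.
(* The expansion has degree one, so the square partial sums are constant from [n = 2] on. *)
apply: cvg_near_cst; exists 2%N => // n /= n2.
rewrite -(subnKC n2) !add2n.
have t0 i j : (1 < i + j)%N -> t i j = 0.
  by rewrite /t /c; case: i j => [|[|i]] [|[|j]] //= _; rewrite !addr0 !mul0r.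
rewrite !big_ord_recl /= big1 => [|j _]; last exact: t0.
have -> : \sum_(j < n - 2) t (bump 0 0) (bump 0 (bump 0 j)) = 0.
  by rewrite big1 // => j _; exact: t0.
have -> : \sum_(i < n - 2) \sum_(j < (n - 2).+2) t (bump 0 (bump 0 i)) j = 0.
  by rewrite big1 // => i _; rewrite big1 // => j _; exact: t0.
by rewrite /t /c /bump /= !expr0 !expr1; ring.
Qed.

Section Segment.
Variable R : realType.

Lemma segment_arc (K : R) : 0 < K ->
  topological_arc [set p : plane R | 0 <= p.1 <= K /\ p.2 = 0].
Proof.
move=> K0; exists (fun t => (K * t, 0)); split.
- apply: continuous_subspaceT => t.
  have ct : K * u @[u --> t] --> K * t by exact: mulrl_continuous.
  exact: (cvg_pair ct (cvg_cst (0 : R))).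
- by move=> s t _ _ [/(mulfI (lt0r_neq0 K0))].
- apply/seteqP; split=> [[x y] [/= /andP[x0 xK] ->]|p [t /= ]].
    exists (x / K); last by rewrite mulrC divfK // gt_eqF.
    by rewrite /= in_itv /= divr_ge0 ?(ltW K0) //= ler_pdivrMr // mul1r.
  rewrite in_itv /= => /andP[t0 t1] <- /=; split=> //.
  by rewrite mulr_ge0 ?(ltW K0) //= -[leRHS]mulr1 ler_pM2l.
Qed.

(* The closed segment is the union of its two end points and of the open
   segment, which are cut out by equations and strict inequalities. *)
Lemma segment_semianalytic (K : R) : 0 < K ->
  semianalytic [set p : plane R | 0 <= p.1 <= K /\ p.2 = 0].
Proof.
move=> K0 p; exists setT; split=> //; first exact: openT.
pose aff (u : R * R * R) (q : plane R) := u.1.1 * q.1 + u.1.2 * q.2 + u.2.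
pose g (i : 'I_3) (j : 'I_2) : R * R * R :=
  match nat_of_ord i, nat_of_ord j with
  | 0, 0 => (1, 0, 0)
  | 1, 0 => (1, 0, - K)
  | _, _ => (0, 1, 0)
  end.
pose h (i : 'I_3) (j : 'I_2) : R * R * R :=
  match nat_of_ord i, nat_of_ord j with
  | 2, 0 => (1, 0, 0)
  | 2, _ => (-1, 0, K)
  | _, _ => (0, 0, 1)
  end.
exists 3%N, 2%N, (fun i j => aff (g i j)), (fun i j => aff (h i j)).
split=> [i j q _|[x y] _]; first by split; exact: affine_analytic_at.
split=> [[/= /andP[]]|[[i ilt] H]].
  rewrite le_eqVlt => /predU1P[<- _ ->|x0].
    exists (inord 0) => -[[|[|//]] jl]; rewrite /aff /g /h inordK //=; split; lra.
  rewrite le_eqVlt => /predU1P[-> ->|xK ->].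
    exists (inord 1) => -[[|[|//]] jl]; rewrite /aff /g /h inordK //=; split; lra.
  exists (inord 2) => -[[|[|//]] jl]; rewrite /aff /g /h inordK //=; split; lra.
have [h00 h01] := H (inord 0); have [h10 h11] := H (inord 1).
move: h00 h01 h10 h11; rewrite /aff /g /h !inordK //=.
by case: i ilt {H} => [|[|[|//]]] ilt /= e1 e2 e3 e4; split; first [apply/andP; split; lra|lra].
Qed.

Lemma segment_finite_arcs (K : R) : 0 < K ->
  finite_arcs_and_points [set p : plane R | 0 <= p.1 <= K /\ p.2 = 0].
Proof.
move=> K0; exists 1%N, (fun=> [set p : plane R | 0 <= p.1 <= K /\ p.2 = 0]), set0; split=> //.
- by move=> _; split; [exact: segment_arc|exact: segment_semianalytic].
- by rewrite setU0; apply/seteqP; split=> [q Sq|q [i _]] //; exists ord0.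
Qed.

(* A point off a segment of the real axis is outside some disc containing the
   segment; it can be taken large, with its centre far away on the other side of
   the axis. *)
Lemma segment_disc (K : R) (p : plane R) : 0 < K -> ~ (0 <= p.1 <= K /\ p.2 = 0) ->
  exists (c : R[i]) (r : R), [/\ 0 < r, r < cmod (toC p - c) &
    forall q : plane R, 0 <= q.1 <= K /\ q.2 = 0 -> cmod (toC q - c) <= r].
Proof.
move=> K0; case: p => x y /= nS.
have cmodE (a b c d : R) : cmod (toC (a, b) - (c +i* d)) = Num.sqrt ((a - c) ^+ 2 + (b - d) ^+ 2) by [].
have [y0|y0] := eqVneq y 0.
  (* On the real axis, the disc having the segment as a diameter is enough. *)
  exists (K / 2)%:C, (K / 2); split; first by rewrite divr_gt0.
    rewrite /real_complex_def cmodE y0 subr0 expr0n addr0 sqrtr_sqr.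
    rewrite ltNge; apply/negP; rewrite ler_norml => /andP[h1 h2]; apply: nS.
    by split=> //; apply/andP; split; lra.
  move=> [a b] [/= /andP[a0 aK] ->].
  by rewrite /real_complex_def cmodE subr0 expr0n addr0 sqrtr_sqr ler_norml; apply/andP; split; lra.
(* The centre is [x - i l y]. Its squared distance to the point, [(1 + l) ^ 2 y ^ 2], exceeds the
   squared radius [(K + |x|) ^ 2 + l ^ 2 y ^ 2] because [l y ^ 2 = (K + |x|) ^ 2]. *)
pose l := (K + `|x|) ^+ 2 / y ^+ 2.
have y2 : 0 < y ^+ 2 by rewrite exprn_even_gt0.
have Kx : 0 < K + `|x| by rewrite ltr_wpDr.
have l0 : 0 < l by rewrite divr_gt0 // exprn_gt0.
have ly : l * y ^+ 2 = (K + `|x|) ^+ 2 by rewrite divfK // gt_eqF.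
pose rr := (K + `|x|) ^+ 2 + (l * y) ^+ 2.
have rr0 : 0 < rr by rewrite ltr_wpDr ?sqr_ge0 // exprn_gt0.
exists (x +i* (- (l * y))), (Num.sqrt rr); split; first by rewrite sqrtr_gt0.
  have yl : 0 < (y - - (l * y)) ^+ 2.
    by rewrite opprK -{1}(mul1r y) -mulrDl exprMn mulr_gt0 // exprn_gt0 // addr_gt0.
  rewrite cmodE subrr expr0n add0r ltr_sqrt // /rr -ly.
  by move: y2; rewrite !expr2 => y2; nra.
move=> [a b] [/= /andP[a0 aK] ->]; rewrite cmodE ler_sqrt; last exact: ltW.
rewrite /rr sub0r opprK lerD2r -[leLHS]real_normK ?num_real // lerXn2r ?nnegrE ?(ltW Kx) //.
by rewrite (le_trans (ler_normB _ _)) // lerD2r ger0_norm.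
Qed.

End Segment.

(** * The Fuss-Catalan polynomial *)

Section FussCatalanPolynomial.
Variables (R : realType) (m : nat).
Hypothesis m2 : (2 <= m)%N.

Lemma psupport_fc_poly j k : psupport (fc_poly R m) (j, k) <->
  [\/ (j = 0 /\ k = 0)%N, (j = 1 /\ k = 1)%N | (j = m - 1 /\ k = m)%N].
Proof.
rewrite /psupport /= coef_fc_poly !coefD coefN !coefMn coefXn coefX coef1.
have [->|km] := eqVneq k m.
  have -> : (m == 1)%N = false by lia.
  have -> : (m == 0)%N = false by lia.
  rewrite !mulr0n subr0 addr0 mulr1n pnatr_eq0 eqb0 negbK.
  split=> [/eqP ->|[[]|[]|[-> _]]]; [by constructor 3|lia|lia|by []].
have [->|k1] := eqVneq k 1%N.
  rewrite mulr0n mulr1n addr0 sub0r oppr_eq0 pnatr_eq0 eqb0 negbK.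
  split=> [/eqP ->|[[]|[]|[]]]; [by constructor 2|lia|by move=> ->|lia].
have [->|k0] := eqVneq k 0%N.
  rewrite !mulr0n mulr1n subr0 add0r pnatr_eq0 eqb0 negbK.
  split=> [/eqP ->|[[]|[]|[]]]; [by constructor 1|by move=> ->|lia|lia].
rewrite !mulr0n subr0 addr0 eqxx; split=> // -[[]|[]|[]]; move: km k1 k0; lia.
Qed.

Lemma fc_poly_balanced : balanced (fc_poly R m).
Proof.
split; first by exists (0, 0)%N => //; apply/psupport_fc_poly; constructor 1.
move=> _ [[j k] /psupport_fc_poly H <-] /=.
by case: H => -[-> ->] //; rewrite subr_ge0 lez_nat leq_subr.
Qed.

Lemma fc_poly_not_excellent : ~ excellent_balanced (fc_poly R m).
Proof.
move=> [_ _ [n [/psupport_fc_poly nn dom]] _].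
have /dom[] : psupport (fc_poly R m) (m - 1, m)%N.
  by apply/psupport_fc_poly; constructor 3.
by move=> _ mn; case: nn => -[]; lia.
Qed.

Lemma eval2_fc_poly z w :
  eval2 (fc_poly R m) z w = z ^+ (m - 1) * w ^+ m - z * w + 1.
Proof. by rewrite /eval2 /fc_poly !hornerE. Qed.

Lemma eval2_fc_poly_eq0 z w : z != 0 ->
  (eval2 (fc_poly R m) z w == 0) = ((z * w) ^+ m == z * (z * w - 1)).
Proof.
move=> z0; rewrite -[LHS](inj_eq (mulfI z0)) mulr0 -[RHS]subr_eq0 eval2_fc_poly.
congr (_ == 0); have -> : (z * w) ^+ m = z * z ^+ (m - 1) * w ^+ m.
  by rewrite exprMn -exprS subn1 prednK //; lia.
by ring.
Qed.

Lemma size_fc_poly : size (fc_poly R m) = m.+1.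
Proof.
apply/eqP; rewrite eqn_leq; apply/andP; split.
  apply/leq_sizeP => k mk; apply/polyP => j; rewrite coef0; apply/eqP.
  by apply/negP => /negP /psupport_fc_poly; case=> -[? ?]; lia.
rewrite ltnNge; apply/negP => /leq_sizeP/(_ m (leqnn _)) E.
have : psupport (fc_poly R m) (m - 1, m)%N by apply/psupport_fc_poly; constructor 3.
by rewrite /psupport /= E coef0 eqxx.
Qed.

Local Notation K := (fc_bound R m).

Lemma fc_bound_gt0 : 0 < K.
Proof. by rewrite divr_gt0 ?exprn_gt0 // ltr0n; lia. Qed.

Lemma exteriorE (r : R) z : exterior r z <-> r < cmod z.
Proof. by rewrite /exterior /= -ltcR. Qed.

(* Two branches with leading term [1 / z] take close values, while distinct
   solutions [u = z w] of [u ^ m = z (u - 1)] satisfy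
   [sum_i u ^ (m - 1 - i) v ^ i = z], which bounds [z]. *)
Lemma probability_branch_unique f g :
  probability_branch (fc_poly R m) f -> probability_branch (fc_poly R m) g ->
  same_germ g f.
Proof.
have im (i : 'I_m) : (m.-1 - i + i = m - 1)%N by have := ltn_ord i; lia.
move=> [[r1 B1] [r2 [M1 L1]]] [[r3 B2] [r4 [M2 L2]]].
(* Beyond [r] both equations and both estimates hold, [z] is nonzero, [M1] and [M2] give
   [cmod (z w) <= 2] for both branches, and the last term exceeds what two distinct solutions would
   allow. *)
pose r := 1 + `|r1| + `|r2| + `|r3| + `|r4| + `|M1| + `|M2| + m%:R * 2 ^+ (m - 1).
exists r => z /exteriorE zr.
have [n1 n2 n3 n4] : [/\ 0 <= `|r1|, 0 <= `|r2|, 0 <= `|r3| & 0 <= `|r4|] by split.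
have [n5 n6] : 0 <= `|M1| /\ 0 <= `|M2| by split.
have [l1 l2 l3 l4] : [/\ r1 <= `|r1|, r2 <= `|r2|, r3 <= `|r3| & r4 <= `|r4|].
  by split; exact: ler_norm.
have [l5 l6] : M1 <= `|M1| /\ M2 <= `|M2| by split; exact: ler_norm.
have n7 : 0 <= m%:R * 2 ^+ (m - 1) :> R by rewrite mulr_ge0 ?exprn_ge0.
have z1 : 1 < cmod z by move: zr; rewrite /r; lra.
have z0 : z != 0 by apply: contraTN z1 => /eqP ->; rewrite cmod0 ltr10.
have u2 h M : M < cmod z -> `|h - 1%:C / z| <= M%:C / `|z| ^+ 2 -> cmod (z * h) <= 2.
  move=> Mz; rewrite (_ : `|h - _| = (cmod (h - 1%:C / z))%:C) //.
  rewrite (_ : `|z| ^+ 2 = (cmod z ^+ 2)%:C); last by rewrite rmorphXn.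
  rewrite -fmorphV -rmorphM lecR => H.
  have -> : z * h = z * (h - 1%:C / z) + 1 by rewrite mulrBr mulrCA divff // mulr1 subrK.
  apply: (le_trans (le_normcD _ _)); rewrite Normc.normc1 Normc.normcM.
  have zz : 0 < cmod z by lra.
  have : cmod z * cmod (h - 1%:C / z) <= 1; last by lra.
  apply: (le_trans (ler_wpM2l (ltW zz) H)).
  rewrite (_ : _ * _ = M / cmod z); last by field; rewrite gt_eqF.
  by rewrite ler_pdivrMr // mul1r ltW.
have uf : cmod (z * f z) <= 2.
  by apply: (u2 _ M1); [move: zr; rewrite /r; lra|apply/L1/exteriorE; move: zr; rewrite /r; lra].
have ug : cmod (z * g z) <= 2.
  by apply: (u2 _ M2); [move: zr; rewrite /r; lra|apply/L2/exteriorE; move: zr; rewrite /r; lra].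
have /eqP Ef : eval2 (fc_poly R m) z (f z) == 0.
  by apply/eqP; have [] := B1 z _ => //; apply/exteriorE; move: zr; rewrite /r; lra.
have /eqP Eg : eval2 (fc_poly R m) z (g z) == 0.
  by apply/eqP; have [] := B2 z _ => //; apply/exteriorE; move: zr; rewrite /r; lra.
move/eqP: Ef; rewrite eval2_fc_poly_eq0 // => /eqP Ef.
move/eqP: Eg; rewrite eval2_fc_poly_eq0 // => /eqP Eg.
apply: (mulfI z0); apply/eqP; rewrite -subr_eq0; apply/negPn/negP => uv.
move: uv Ef Eg uf ug; move: (z * f z) (z * g z) => u v uv Eu Ev cu cv.
have : (v - u) * (\sum_(i < m) v ^+ (m.-1 - i) * u ^+ i) = (v - u) * z.
  by rewrite -subrXX Eu Ev; ring.
move=> /(mulfI uv) zE.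
suff : cmod z <= m%:R * 2 ^+ (m - 1) by move: zr; rewrite /r; lra.
rewrite -zE; apply: (le_trans (cmod_sum _)).
have -> : m%:R * 2 ^+ (m - 1) = \sum_(i < m) 2 ^+ (m - 1) :> R.
  by rewrite sumr_const card_ord mulr_natl.
apply: ler_sum => i _; rewrite Normc.normcM !cmodX.
have -> : 2 ^+ (m - 1) = 2 ^+ (m.-1 - i) * 2 ^+ i :> R.
  by rewrite -exprD im.
by rewrite ler_pM ?exprn_ge0 ?cmod_ge0 // lerXn2r ?nnegrE ?cmod_ge0.
Qed.

End FussCatalanPolynomial.

(** * Conclusion *)

Section FussCatalanCauchy.
Variables (R : realType) (m : nat).
Hypothesis m2 : (2 <= m)%N.

Local Notation K := (fc_bound R m).
Local Notation S := (fc_segment R m).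

Lemma fc_segment_radius p : S p -> cmod (toC p) <= K.
Proof.
case: p => x y [/= /andP[x0 xK] ->].
by rewrite [toC _]/(x%:C) cmod_real ger0_norm.
Qed.

Lemma fuss_catalan_moment k :
  'C(m * k, k)%:R / ((m - 1) * k + 1)%:R = (raney m k 1)%:R :> R[i].
Proof.
have n0 : ((m - 1) * k + 1)%:R != 0 :> R[i] by rewrite pnatr_eq0 addn1.
by apply: (mulIf n0); rewrite divfK // -natrM raney1 //; lia.
Qed.

Lemma fc_measure_fuss_catalan : fuss_catalan m (fc_measure R m2).
Proof.
split=> [|k]; first exact: fc_measure_supported.
by rewrite fuss_catalan_moment -(fc_measure_cint R m2).
Qed.

Variable mu : probability (plane R) R.
Hypothesis mu_fc : fuss_catalan m mu.

Let muS : mu (~` S) = 0%E. Proof. by case: mu_fc. Qed.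
Let mS : measurable S. Proof. exact: measurable_fc_segment. Qed.
Let K0 : 0 < K. Proof. exact: fc_bound_gt0. Qed.
Let moments n : cint mu (fun p => toC p ^+ n) = (raney m n 1)%:R.
Proof. by case: mu_fc => _ /(_ n); rewrite fuss_catalan_moment. Qed.

Lemma fc_cauchy_branch p : ~ S p ->
  derivable (cauchy_transform mu : R[i]^o -> R[i]^o) (toC p) 1 /\
  eval2 (fc_poly R m) (toC p) (cauchy_transform mu (toC p)) = 0.
Proof.
move=> nSp; have [c [r [r0 rp Sr]]] := segment_disc K0 nSp; split.
  have d0 : 0 < cmod (toC p - c) - r by rewrite subr_gt0.
  apply: (cauchy_derivable mS muS d0) => q Sq.
  have := cmodB_ge (toC p - c) (toC q - c); have := Sr q Sq.
  by rewrite opprB addrA subrK; lra.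
(* The origin lies on the segment, so the form of the equation in [u = z w] is available here. *)
have z0 : toC p != 0.
  apply/eqP => -[p1 p2]; apply: nSp; split; last exact: p2.
  by rewrite p1 lexx ltW.
apply/eqP; rewrite eval2_fc_poly_eq0 //; apply/eqP.
exact: (cauchy_eq_disc mS muS K0 fc_segment_radius moments r0 rp Sr).
Qed.

Lemma fc_cauchy_branch_at_infty : branch_at_infty (fc_poly R m) (cauchy_transform mu).
Proof.
exists K => -[x y] /exteriorE zK; apply: (fc_cauchy_branch (p := (x, y))).
by move=> /fc_segment_radius /(lt_le_trans zK); rewrite ltxx.
Qed.

Lemma fc_cauchy_leading_term : leading_term 1 (cauchy_transform mu).
Proof.
(* For [cmod z > 2 K] the difference [1 / (z - p) - 1 / z = p / (z (z - p))] is at most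
   [2 K / cmod z ^ 2]; [cint_bound] doubles this. *)
exists (2 * K), (4 * K) => z /exteriorE zK.
have K0' := K0; have z0 : 0 < cmod z by lra.
have zn0 : z != 0 by apply: contraTN z0 => /eqP ->; rewrite cmod0 ltxx.
have den p : S p -> cmod z / 2 <= cmod (z - toC p).
  by move=> /fc_segment_radius pK; have := cmodB_ge z (toC p); lra.
have z20 : 0 < cmod z / 2 by rewrite divr_gt0.
have bz := cauchy_bounded z20 den.
have b1 : cbounded S (fun=> - z^-1) (cmod (- z^-1)).
  by split=> //; exact: cmeasurable_cst.
have [md _] := cboundedD bz b1.
have bd : cbounded S (fun p => (z - toC p)^-1 + - z^-1) (2 * K / cmod z ^+ 2).
  split=> // p Sp; have pK := fc_segment_radius Sp.
  have zp : z - toC p != 0.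
    by apply/eqP => E; have := den p Sp; rewrite E cmod0 => /(lt_le_trans z20); rewrite ltxx.
  have -> : (z - toC p)^-1 + - z^-1 = toC p * (z^-1 * (z - toC p)^-1).
    by move: (toC p) zp => w zp; field; rewrite zn0 zp.
  rewrite !Normc.normcM !Normc.normcV.
  have -> : 2 * K / cmod z ^+ 2 = K * ((cmod z)^-1 * (cmod z / 2)^-1).
    by field; rewrite gt_eqF.
  rewrite ler_pM ?cmod_ge0 ?mulr_ge0 ?invr_ge0 ?cmod_ge0 // ler_wpM2l ?invr_ge0 ?cmod_ge0 //.
  by rewrite lef_pV2 ?posrE ?den // (lt_le_trans z20) // den.
have := cint_bound mS muS bd; rewrite (cintD mS muS bz b1) cint_cst -cauchy_cint => B.
rewrite (_ : `|_ - _| = (cmod (cauchy_transform mu z - 1%:C / z))%:C) //.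
rewrite (_ : `|z| ^+ 2 = (cmod z ^+ 2)%:C); last by rewrite rmorphXn.
rewrite -fmorphV -rmorphM lecR [1%:C / z]mul1r (le_trans B) //.
by rewrite le_eqVlt; apply/orP; left; apply/eqP; ring.
Qed.

Lemma fc_cauchy_probability_branch :
  probability_branch (fc_poly R m) (cauchy_transform mu).
Proof.
by split; [exact: fc_cauchy_branch_at_infty|exact: fc_cauchy_leading_term].
Qed.

End FussCatalanCauchy.

(** * Area and vanishing of the defect *)

Section NullSupport.
Import HBNNSimple.

(** The integral is a supremum over nonnegative simple functions below [f]; each vanishes off [N],
    so each of its nonzero values is taken on a null set. This reaches the integrand of [defect]
    without a study of its measurability. *)
Lemma integral_null_support d (T : measurableType d) (R : realType)
    (mu : {measure set T -> \bar R}) (N D : set T) (f : T -> \bar R) :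
  measurable N -> mu N = 0%E -> (forall x, 0 <= f x)%E ->
  (forall x, ~ N x -> f x = 0%E) -> (\int[mu]_(x in D) f x = 0)%E.
Proof.
move=> mN N0 f0 fN; apply/eqP; rewrite eq_le integral_ge0 ?andbT //.
rewrite ge0_integralE //; apply: ge_ereal_sup => _ [h /= hf <-].
rewrite /sintegral fsbig1 // => x _; have [->|x0] := eqVneq x 0; first by rewrite mul0e.
suff -> : mu (h @^-1` [set x]) = 0%E by rewrite mule0.
apply: (subset_measure0 _ mN _ N0) => // p /= hp; apply: contrapT => /fN fp.
have := hf p; rewrite hp /patch; case: ifP => _; rewrite ?fp lee_fin => x_le0.
  have : 0 <= h p by exact: fun_ge0.
  by rewrite hp => x_ge0; move/eqP: x0; apply; apply/eqP; rewrite eq_le x_le0.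
have : 0 <= h p by exact: fun_ge0.
by rewrite hp => x_ge0; move/eqP: x0; apply; apply/eqP; rewrite eq_le x_le0.
Qed.

End NullSupport.

Section Area.
Variable R : realType.

(** Lebesgue measure lives on an alias of [R] with another display; the measure laws are transported
    from there to [area], on the sigma-algebra of the plane. *)
Let leb2 : {measure set (measurableTypeR R * measurableTypeR R) -> \bar R} :=
  (@lebesgue_measure R \x @lebesgue_measure R)%E.

Let area0 : area R set0 = 0%E.
Proof. exact: (measure0 leb2). Qed.

Let area_ge0 A : (0 <= area R A)%E.
Proof. exact: (measure_ge0 leb2). Qed.

Let area_sigma_additive : semi_sigma_additive (area R).
Proof. exact: (@measure_semi_sigma_additive _ _ _ leb2). Qed.

HB.instance Definition _ := isMeasure.Build _ _ _ (area R)
  area0 area_ge0 area_sigma_additive.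

Lemma defect_ge0 (P : {poly {poly R[i]}}) (A : set (plane R))
    (mu : {finite_measure set (plane R) -> \bar R}) : (0 <= defect P A mu)%E.
Proof. by apply: integral_ge0 => p _; rewrite lee_fin powR_ge0. Qed.

End Area.

Section FussCatalanMotherBody.
Variables (R : realType) (m : nat).
Hypothesis m2 : (2 <= m)%N.

Local Notation S := (fc_segment R m).
Local Notation mu := (fc_measure R m2).

Lemma fc_mother_body :
  mother_body (fc_poly R m) (cauchy_transform mu) mu.
Proof.
have fc := fc_measure_fuss_catalan R m2.
have supp : msupport mu = S := fc_measure_full_support R m2.
split; first by split; [exact: fc_poly_irreducible|exact: fc_cauchy_branch_at_infty].
split.
- by rewrite supp; exact: compact_fc_segment.
- by exists 0.
- by rewrite supp; apply: segment_finite_arcs; exact: fc_bound_gt0.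
- move=> p _ z [q Hq <-]; apply: fc_cauchy_branch => //.
  by have /= := @connected_component_sub _ (~` msupport mu) p q Hq; rewrite supp.
Qed.

Lemma area_fc_segment : area R S = 0%E.
Proof.
have mI : measurable (`[0, fc_bound R m]%classic : set (measurableTypeR R)) by [].
have m0 : measurable ([set 0] : set (measurableTypeR R)) by [].
rewrite fc_segmentE.
transitivity (@lebesgue_measure R `[0%R, fc_bound R m] * @lebesgue_measure R [set 0%R])%E.
  exact: (product_measure1E (@lebesgue_measure R) (@lebesgue_measure R) mI m0).
by rewrite lebesgue_measure_set1 mule0.
Qed.

Lemma fc_defect (A : set (plane R)) : defect (fc_poly R m) A mu = 0%E.
Proof.
have fc := fc_measure_fuss_catalan R m2.
rewrite /defect.
apply: (@integral_null_support _ _ _ (area R) S A _ (@measurable_fc_segment R m) area_fc_segment) => [p|p nSp].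
  by rewrite lee_fin powR_ge0.
have [_ ->] := fc_cauchy_branch m2 fc nSp.
(* The exponent is [1 / m], hence nonzero, which makes this power of 0 equal to 0. *)
by rewrite cmod0 powR0 // invr_neq0 // pnatr_eq0 size_fc_poly //; lia.
Qed.

End FussCatalanMotherBody.

Theorem theorem8p2 (R : realType) (m : nat) (hm : (2 <= m)%N) :
  [/\ irreducible_elt (fc_poly R m),
      balanced (fc_poly R m),
      ~ excellent_balanced (fc_poly R m) &
      exists f : R[i] -> R[i],
        [/\ unique_probability_branch (fc_poly R m) f,
            exists mu : probability (plane R) R, fuss_catalan m mu,
            forall mu : probability (plane R) R,
              fuss_catalan m mu -> same_germ (cauchy_transform mu) f,
            exists mu : {finite_measure set (plane R) -> \bar R},
              mother_body (fc_poly R m) f mu &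
            forall K : set (plane R),
              compact K -> convex_plane K -> fc_segment R m `<=` K ->
              is_delta (fc_poly R m) f K 0%E]].
Proof.
have fc := fc_measure_fuss_catalan R hm.
have pb := fc_cauchy_probability_branch hm fc.
split.
- exact: fc_poly_irreducible.
- exact: fc_poly_balanced.
- exact: fc_poly_not_excellent.
exists (cauchy_transform (fc_measure R hm)); split.
- by split=> // g; exact: probability_branch_unique.
- by exists (fc_measure R hm).
(* Any measure with these moments has a Cauchy transform that is a probability branch, so uniqueness
   of that branch identifies the germs without determinacy of the moment problem. *)
- move=> mu mufc; apply: (probability_branch_unique hm pb).
  exact: fc_cauchy_probability_branch.
- by exists (fc_measure R hm); exact: fc_mother_body.
move=> K _ _ SK; split.
  exists (fc_measure R hm); last exact: fc_defect.
  split; last by exists 0.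
  by rewrite [msupport _](fc_measure_full_support R hm).
by move=> _ [nu _ <-]; exact: defect_ge0.
Qed.
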